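(* Let $\omega\in[\sec^{-1}(2.2),\pi/2]$ and let $S_\omega$ be an arbitrary balanced maximum sofa with rotation angle $\omega$ and area $|S_\omega|\ge 2.2$. Then a rotated copy of $S_\omega$ admits a movement inside the hallway $L$ with rotation angle $\pi/2$.
   Context: $|X|$ is area. $u_t=(\cos t,\sin t)$, $v_t=(-\sin t,\cos t)$. $S^1=\mathbb{R}/2\pi\mathbb{Z}$. A convex body is a nonempty compact convex subset of $\mathbb{R}^2$; for compact nonempty $S$, $h_S(t)=\sup\{s\cdot u_t:s\in S\}$. Moving sofas. $L=H_L\cup V_L$, $H_L=(-\infty,1]\times[0,1]$, $V_L=[0,1]\times(-\infty,1]$. A moving sofa is a nonempty connected closed set $S$ for which there is a continuous curve $\Phi:[0,1]\to\mathrm{SE}(2)$ (a movement inside $L$) with $\Phi_0$ a translation, $\Phi_0(S)\subseteq H_L$, $\Phi_s(S)\subseteq L$ for all $s$, $\Phi_1(S)\subseteq V_L$. The rotation angle of the movement is the total clockwise angle by which it rotates $S$ (continuous lift of the clockwise angle of $\Phi_s$, starting at $0$ when $s=0$, evaluated at $s=1$). For $\omega\in(0,\pi/2]$, a moving sofa with rotation angle $\omega$ is in standard position if $h_S(\omega)=h_S(\pi/2)=1$. For nonempty compact $S$ let $Q^+_S(t)=\{p:p\cdot u_t\le h_S(t),\ p\cdot v_t\le h_S(t+\pi/2)\}$, $Q^-_S(t)=\{p:p\cdot u_t<h_S(t)-1,\ p\cdot v_t<h_S(t+\pi/2)-1\}$, $L_S(t)=Q_S^+(t)\setminus Q_S^-(t)$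 (the supporting hallway of angle $t$). Let $P_\omega=\{p: 0\le p\cdot u_\omega\le 1,\ 0\le p\cdot u_{\pi/2}\le 1\}$, $F_\omega=\{p:p\cdot u_\omega\ge0,\ p\cdot u_{\pi/2}\ge 0\}$, $o_\omega=(\tan(\pi/4-\omega/2),1)$. For a moving sofa $S$ with rotation angle $\omega$ in standard position, $\mathcal{I}(S)=P_\omega\cap\bigcap_{t\in[0,\omega]}L_S(t)$ and its cap is $\mathcal{C}(S)=P_\omega\cap\bigcap_{t\in[0,\omega]}Q_S^+(t)$. A monotone sofa (with rotation angle $\omega$) is a set of the form $\mathcal{I}(S)$ for such an $S$. Caps. A cap with rotation angle $\omega$ is a convex body $K$ with $h_K(\omega)=h_K(\pi/2)=1$, $h_K(\omega+\pi)=h_K(3\pi/2)=0$, which is an intersection of closed half-planes $\{p:p\cdot u_t\le c\}$ with $t\in[0,\omega]\cup[\pi/2,\omega+\pi/2]\cup\{\omega+\pi,3\pi/2\}$. $\mathcal{K}^{\mathrm c}_\omega$ is the set of these caps. Balanced maximum caps. An angle set $\Theta$ (with rotation angle $\omega$) is a nonempty finite subset of $(0,\omega)$; $\Theta^\diamond=\Theta\cup(\Theta+\pi/2)\cup\{\omega,\pi/2\}$. $\mathcal{K}^{\mathrm c}_\Theta$ is the set of $K\in\mathcal{K}^{\mathrm c}_\omega$ that are intersections of closed half-planes $\{p\cdot u_t\le c\}$ with $t\in\Theta^\diamond\cup\{\omega+\pi,3\pi/2\}$. $\mathcal{N}_\Theta(K)=F_\omega\cap\bigcup_{t\in\Theta}Q_K^-(t)$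 and $\mathcal{A}_\Theta(K)=|K|-|\mathcal{N}_\Theta(K)|$ for $K\in\mathcal{K}^{\mathrm c}_\Theta$. A maximum polygon cap with angle set $\Theta$ is a $K\in\mathcal{K}^{\mathrm c}_\Theta$ with $o_\omega\in K$ maximizing $\mathcal{A}_\Theta$ over $\mathcal{K}^{\mathrm c}_\Theta$. A balanced maximum cap with rotation angle $\omega$ is a $K\in\mathcal{K}^{\mathrm c}_\omega$ for which there are powers of two $1<n_1<n_2<\cdots$ and, for each $i\ge1$, a maximum polygon cap $K_i$ with angle set $\{j\omega/n_i:1\le j<n_i\}$, such that $K_i\to K$ in Hausdorff distance. A balanced maximum sofa with rotation angle $\omega$ is a monotone sofa $S$ whose cap $\mathcal{C}(S)$ is a balanced maximum cap with rotation angle $\omega$. *)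

(* Defs.v *)
(* The plane is R * R for R : realType. *)
From HB Require Import structures.
From mathcomp Require Import all_boot all_order all_algebra.
From mathcomp Require Import all_classical all_reals all_analysis.
Set Implicit Arguments.
Unset Strict Implicit.
Unset Printing Implicit Defensive.
Import Order.TTheory GRing.Theory Num.Theory.
Import numFieldNormedType.Exports.
Local Open Scope classical_set_scope.
Local Open Scope ring_scope.

Definition asec {R : realType} (x : R) : R := acos x^-1.

Section Plane.
Variable R : realType.
Implicit Types (p q : R * R) (X Y S : set (R * R)) (t c omega : R).

(* All sets whose area is taken below are Borel, so the product measure on the
   product sigma-algebra agrees with planar Lebesgue measure on them. *)
Definition area X : \bar R := (lebesgue_measure \x lebesgue_measure)%E X.

Definition dot p q : R := p.1 * q.1 + p.2 * q.2.

(* Angles are real representatives of elements of R/2piZ. *)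
Definition u_ t : R * R := (cos t, sin t).
Definition v_ t : R * R := (- sin t, cos t).

(* The library norm on R * R is the sup norm. *)
Definition edist p q : R :=
  Num.sqrt ((p.1 - q.1) ^+ 2 + (p.2 - q.2) ^+ 2).

Definition excess X Y : R :=
  sup [set inf [set edist p q | q in Y] | p in X].

Definition hausdorff_dist X Y : R := Num.max (excess X Y) (excess Y X).

Definition convex_body X : Prop :=
  [/\ X !=set0, compact X
    & convex_set (X : set (convex_lmodType (R^o * R^o)%type))].

Definition supp X t : R := sup [set dot p (u_ t) | p in X].

Definition halfplane t c : set (R * R) := [set p | dot p (u_ t) <= c].

Definition halfplane_intersection (T : set R) X : Prop :=
  exists2 A : set (R * R), (forall a, A a -> T a.1)
    & X = \bigcap_(a in A) halfplane a.1 a.2.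

(* An orientation-preserving isometry p |-> z p + c of the plane, identified
   with the complex numbers, is encoded as the pair (z, c) with |z| = 1. *)
Definition SE2 : set ((R * R) * (R * R)) :=
  [set g | g.1.1 ^+ 2 + g.1.2 ^+ 2 = 1].

Definition se2_act (g : (R * R) * (R * R)) p : R * R :=
  (g.1.1 * p.1 - g.1.2 * p.2 + g.2.1, g.1.2 * p.1 + g.1.1 * p.2 + g.2.2).

Definition se2_translation (g : (R * R) * (R * R)) : Prop := g.1 = (1, 0).

Definition rotated_copy t X : set (R * R) :=
  se2_act (u_ t, (0, 0)) @` X.

Definition H_L : set (R * R) := [set p | p.1 <= 1 /\ 0 <= p.2 <= 1].
Definition V_L : set (R * R) := [set p | 0 <= p.1 <= 1 /\ p.2 <= 1].
Definition L : set (R * R) := H_L `|` V_L.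

Definition movement S (Phi : R -> (R * R) * (R * R)) : Prop :=
  [/\ forall s, s \in `[0, 1] -> SE2 (Phi s),
      {within `[0, 1], continuous Phi},
      se2_translation (Phi 0),
      forall s, s \in `[0, 1] -> se2_act (Phi s) @` S `<=` L
    & se2_act (Phi 0) @` S `<=` H_L /\ se2_act (Phi 1) @` S `<=` V_L].

(* alpha is the continuous lift of the clockwise angle of Phi *)
Definition rotation_angle (Phi : R -> (R * R) * (R * R)) omega : Prop :=
  exists alpha : R -> R,
    [/\ {within `[0, 1], continuous alpha},
        forall s, s \in `[0, 1] ->
          (Phi s).1 = (cos (alpha s), - sin (alpha s)),
        alpha 0 = 0
      & alpha 1 = omega].

Definition moving_sofa_with_angle omega S : Prop :=
  [/\ S !=set0, connected S, closed S
    & exists2 Phi, movement S Phi & rotation_angle Phi omega].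

(* For 0 < omega <= pi/2 a moving sofa with rotation angle omega is bounded,
   hence compact, so that supp S is its actual support function. *)
Definition standard_position omega S : Prop :=
  supp S omega = 1 /\ supp S (pi / 2) = 1.

Definition Qplus S t : set (R * R) :=
  [set p | dot p (u_ t) <= supp S t /\ dot p (v_ t) <= supp S (t + pi / 2)].

Definition Qminus S t : set (R * R) :=
  [set p | dot p (u_ t) < supp S t - 1 /\
           dot p (v_ t) < supp S (t + pi / 2) - 1].

Definition supporting_hallway S t : set (R * R) := Qplus S t `\` Qminus S t.

Definition P_ omega : set (R * R) :=
  [set p | 0 <= dot p (u_ omega) <= 1 /\ 0 <= dot p (u_ (pi / 2)) <= 1].

Definition F_ omega : set (R * R) :=
  [set p | 0 <= dot p (u_ omega) /\ 0 <= dot p (u_ (pi / 2))].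

Definition o_ omega : R * R := (tan (pi / 4 - omega / 2), 1).

Definition monotonization omega S : set (R * R) :=
  P_ omega `&` \bigcap_(t in `[0, omega]) supporting_hallway S t.

Definition cap_of omega S : set (R * R) :=
  P_ omega `&` \bigcap_(t in `[0, omega]) Qplus S t.

Definition monotone_sofa omega S : Prop :=
  exists S', [/\ moving_sofa_with_angle omega S',
                 standard_position omega S'
               & S = monotonization omega S'].

Definition cap omega : set (set (R * R)) :=
  [set K | [/\ convex_body K,
    supp K omega = 1 /\ supp K (pi / 2) = 1,
    supp K (omega + pi) = 0 /\ supp K (3 * pi / 2) = 0
  & halfplane_intersection
      (`[0, omega] `|` `[pi / 2, omega + pi / 2]
       `|` [set omega + pi; 3 * pi / 2]) K]].

Definition angle_set omega (Theta : set R) : Prop :=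
  [/\ Theta !=set0, finite_set Theta & Theta `<=` `]0, omega[].

Definition diamond omega (Theta : set R) : set R :=
  Theta `|` [set t + pi / 2 | t in Theta] `|` [set omega; pi / 2].

Definition polygon_cap omega (Theta : set R) : set (set (R * R)) :=
  [set K | cap omega K /\
    halfplane_intersection
      (diamond omega Theta `|` [set omega + pi; 3 * pi / 2]) K].

Definition polygon_niche omega (Theta : set R) (K : set (R * R)) :
    set (R * R) :=
  F_ omega `&` \bigcup_(t in Theta) Qminus K t.

(* Both areas are finite for K a cap. *)
Definition polygon_area omega (Theta : set R) (K : set (R * R)) : \bar R :=
  (area K - area (polygon_niche omega Theta K))%E.

Definition maximum_polygon_cap omega (Theta : set R) (K : set (R * R)) :
    Prop :=
  [/\ angle_set omega Theta, polygon_cap omega Theta K, K (o_ omega)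
    & forall K', polygon_cap omega Theta K' ->
        (polygon_area omega Theta K' <= polygon_area omega Theta K)%E].

Definition uniform_angle_set omega (n : nat) : set R :=
  [set j%:R * omega / n%:R | j in [set j : nat | (1 <= j < n)%N]].

Definition balanced_maximum_cap omega (K : set (R * R)) : Prop :=
  cap omega K /\
  exists (n : nat -> nat) (K_ : nat -> set (R * R)),
    [/\ forall i, exists k, n i = (2 ^ k)%N,
        (1 < n 0)%N,
        forall i, (n i < n i.+1)%N,
        forall i, maximum_polygon_cap omega (uniform_angle_set omega (n i))
                    (K_ i)
      & hausdorff_dist (K_ i) K @[i --> \oo] --> (0 : R)].

Definition balanced_maximum_sofa omega S : Prop :=
  monotone_sofa omega S /\ balanced_maximum_cap omega (cap_of omega S).

End Plane.

(* Main.v *)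
Require Import Defs.
From mathcomp Require Import all_boot all_order all_algebra.
From mathcomp Require Import all_classical all_reals all_analysis.
From mathcomp Require Import measurable_realfun ring lra.
Set Implicit Arguments.
Unset Strict Implicit.
Unset Printing Implicit Defensive.
Import Order.TTheory GRing.Theory Num.Theory.
Import numFieldNormedType.Exports.
Local Open Scope classical_set_scope.
Local Open Scope ring_scope.

(** Write [w] for the angle, [c] and [s] for its cosine and sine, and [K] for the cap of [S].

    The motion. Every point of [S] lies in [K] and outside the inner quadrants [Qminus K t] with
    [0 <= t <= w], so [S] stays in the supporting hallways of [K] for these angles. Carrying the
    supporting hallway of angle [t] onto [L], for [t] from [0] to [pi / 2], is a continuous motion
    of total angle [pi / 2] ([hallway_motion]). It remains to see that for [w <= t <= pi / 2] the sofa
    lies in the strip of width one below the supporting line of [K] with normal [u_ t]. For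
    [w < pi / 2] this is [sofa_in_strip].

    The strip. [K] lies in the thin rhombus [P_ w], whose top corner is [o_ w]. A point [z] of [S]
    that violates the strip condition sits near the bottom corner of the rhombus, at distance more
    than one from [o_ w], and lies in no inner quadrant. By [long_tip], an area of at least 2.2
    forces one of the two acute tips of [K] to be far from the bottom corner, since the rhombus cut
    off near both tips has area less than 2.2. The reflection in the axis of the rhombus exchanges
    the two tips; let the left one be far. Then for some angle [t] slightly below [w] the point [z]
    cannot lie in the arm of the hallway that contains the left tip, so it lies in the other arm, and
    this bounds [supp K t] ([blocked_support]). Consequently the upper right edge of [K], which
    starts at [o_ w], has length less than [2 * c].

    The balance. In a maximum polygon cap, the upper right edge is at least as long as the part of
    the lower left edge that the niche leaves uncovered ([balance_left]). To see this, translate all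
    the sides of the cap that are not sides of the rhombus, together with the inner quadrants. The
    areas change only in slabs along the sides of the rhombus, so the first-order terms are lengths of
    edges ([first_order_balance]). The direction [u_ a] of the translation has to keep [o_ w] in the
    cap: [a] is the last angle at which a left side of the cap passes through [o_ w], or [0]. Since
    the niche cannot reach far along a long lower left edge ([support_v_le_corner]), the upper right
    edge has length at least [2 * c]. Both statements involve only two support numbers, so they can
    be confronted on a polygon cap close to [K] ([balance_gap_absurd]).

    Coordinates. In the oblique coordinates [(dot p (u_ w), p.2)] the rhombus is the unit square, the
    slabs are boxes, and the reflection in the axis swaps the coordinates and exchanges [t] with
    [w - t]. The argument is carried out there for a measure that is invariant under translations, and
    the two reflected statements come from two choices of this measure. *)

(** * Area: monotonicity, isometries, parallelograms *)

Section Area.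
Context {R : realType}.
Notation mu := (@lebesgue_measure R).

Lemma lebesgue_measure_mono (X Y : set (measurableTypeR R)) : X `<=` Y -> (mu X <= mu Y)%E.
Proof.
move=> XY. rewrite /lebesgue_measure /lebesgue_stieltjes_measure.
exact: le_mu_ext.
Qed.

(** Holds for all sets: Lebesgue measure is an outer measure on the whole power set, and the integral
    of a nonnegative function is a supremum over the simple functions below it. *)
Lemma area_mono (X Y : set (R * R)) : X `<=` Y -> (area X <= area Y)%E.
Proof.
move=> XY; rewrite /area /product_measure1.
rewrite !ge0_integralTE; try by move=> x; exact: measure_ge0.
all: try (by move=> x; rewrite /lebesgue_measure /lebesgue_stieltjes_measure; exact: outer_measure_ge0).
apply: ge_ereal_sup => _ [h hX <-]; apply: ereal_sup_ubound; exists h => // x.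
apply: (le_trans (hX x)); apply: lebesgue_measure_mono => y /=.
by rewrite /xsection /= !inE; exact: XY.
Qed.

Lemma lebesgue_measure_isometry (a : R) (e : bool) (X : set (measurableTypeR R)) :
  measurable X ->
  mu ((fun x : measurableTypeR R => (a + (-1) ^+ e * x : measurableTypeR R)) @^-1` X) = mu X.
Proof.
move=> mX.
pose f := (fun x : measurableTypeR R => (a + (-1) ^+ e * x : measurableTypeR R)).
have mf : measurable_fun setT f.
  by apply: measurable_funD => //; apply: measurable_funM.
apply/esym; apply: (@lebesgue_measure_unique R (pushforward mu f)) => //.
move=> _ [[x y] _ <-] /=; rewrite /pushforward.
have -> : f @^-1` `]x, y] = if e then `[a - y, a - x[%classic else `]x - a, y - a]%classic.
  apply/seteqP; split => z; rewrite /f /=; case: (e);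
   rewrite ?expr0 ?expr1 /= !in_itv /=; lra.
by case: (e); rewrite !lebesgue_measure_itv /= !lte_fin; case: ifP; case: ifP => ??;
  try (exfalso; lra); rewrite -?EFinB; try (congr EFin; ring).
Qed.

Lemma measurable_fun_affine (x y k : R) :
  measurable_fun setT (fun p : measurableTypeR R * measurableTypeR R =>
    x * p.1 + y * p.2 + k : measurableTypeR R).
Proof.
apply: measurable_funD => //.
by apply: measurable_funD; apply: measurable_funM.
Qed.

Lemma area_isometry (a : R * R) (e : bool) (X : set (R * R)) :
  measurable (X : set (measurableTypeR R * measurableTypeR R)) ->
  area ((fun p => (a.1 + (-1) ^+ e * p.1, a.2 + (-1) ^+ e * p.2)) @^-1` X) = area X.
Proof.
move=> mX.
pose f := (fun p : measurableTypeR R * measurableTypeR R =>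
  (a.1 + (-1) ^+ e * p.1, a.2 + (-1) ^+ e * p.2) : measurableTypeR R * measurableTypeR R).
pose g b := (fun x : measurableTypeR R => (b + (-1) ^+ e * x : measurableTypeR R)).
have mg b : measurable_fun setT (g b).
  by apply: measurable_funD => //; apply: measurable_funM.
have mf : measurable_fun setT f.
  apply: measurable_fun_pair.
  - by apply: (measurableT_comp (mg a.1)); exact: measurable_fst.
  - by apply: (measurableT_comp (mg a.2)); exact: measurable_snd.
apply/esym; apply: (@product_measure_unique _ _ _ _ _ mu mu (pushforward (mu \x mu)%E f)) => //.
move=> A B mA mB.
change ((mu \x mu)%E ((g a.1 @^-1` A) `*` (g a.2 @^-1` B)) = (mu A * mu B)%E).
rewrite product_measure1E.
- by congr (_ * _)%E; exact: lebesgue_measure_isometry.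
- by rewrite -[X in measurable X]setTI; exact: mg.
- by rewrite -[X in measurable X]setTI; exact: mg.
Qed.

Lemma area_ysection (X : set (R * R)) :
  measurable (X : set (measurableTypeR R * measurableTypeR R)) ->
  area X = (\int[mu]_y mu (ysection X y))%E.
Proof.
move=> mX.
rewrite /area (@product_measure_unique _ _ _ _ _ mu mu (mu \x^ mu)%E)//.
by move=> A B mA mB; exact: product_measure2E.
Qed.

Lemma area_parallelogram (c s a b u v : R) (b1 b2 b3 b4 : bool) : 0 < c -> a <= b -> u <= v ->
  area [set p : R * R | (c * p.1 + s * p.2 \in Interval (BSide b1 a) (BSide b2 b)) /\
    (p.2 \in Interval (BSide b3 u) (BSide b4 v))] = ((b - a) * (v - u) / c)%:E.
Proof.
move=> c0 ab uv; set X := (X in area X).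
pose I := Interval (BSide b1 a) (BSide b2 b); pose J := Interval (BSide b3 u) (BSide b4 v).
have mX : measurable (X : set (measurableTypeR R * measurableTypeR R)).
  have -> : X = (fun p : measurableTypeR R * measurableTypeR R =>
    c * p.1 + s * p.2 + 0 : measurableTypeR R) @^-1` [set` I]
     `&` snd @^-1` [set` J].
    by apply/seteqP; split => p /=; rewrite addr0.
  apply: measurableI.
    by rewrite -[X in measurable X]setTI; apply: measurable_fun_affine.
  by rewrite -[X in measurable X]setTI; apply: measurable_snd.
rewrite area_ysection//.
rewrite (@eq_integral _ _ _ mu setT (fun y => ((b - a) / c)%:E * (\1_[set` J] y)%:E)%E); last first.
  move=> y _; rewrite indicE; case: (boolP (y \in [set` J])) => [yJ|yJ].
    have -> : ysection X y = [set` Interval (BSide b1 ((a - s * y) / c)) (BSide b2 ((b - s * y) / c))].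
      apply/seteqP; split => x; rewrite /ysection /= inE /X /=.
        move=> [h _]; move: h.
        rewrite !in_itv /=; case: (b1); case: (b2) => /=;
        rewrite ?ler_pdivrMr ?ler_pdivlMr ?ltr_pdivrMr ?ltr_pdivlMr//; lra.
      move=> h; split; last by move: yJ; rewrite inE.
      move: h; rewrite !in_itv /=; case: (b1); case: (b2) => /=;
        rewrite ?ler_pdivrMr ?ler_pdivlMr ?ltr_pdivrMr ?ltr_pdivlMr//; lra.
    rewrite lebesgue_measure_itv /= mule1 lte_fin ltr_pM2r ?invr_gt0// ltrD2r.
    case: ifPn => [h|]; first by rewrite -EFinB; congr EFin; ring.
    rewrite -leNgt => h; have -> : b = a by apply/eqP; rewrite eq_le ab h.
    by rewrite subrr mul0r.
  rewrite mule0 [ysection X y](_ : _ = set0) ?measure0//.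
  rewrite -subset0 => x; rewrite /ysection /= inE /X /= => -[_ h].
  by move/negP: yJ; apply; rewrite inE.
rewrite ge0_integralZl//; last by rewrite lee_fin divr_ge0 ?subr_ge0// ltW.
have mJ : mu [set` J] = (v - u)%:E.
  rewrite lebesgue_measure_itv /= lte_fin; case: ifPn => [h|]; first by rewrite -EFinB.
  rewrite -leNgt => h; have -> : v = u by apply/eqP; rewrite eq_le uv h.
  by rewrite subrr.
rewrite integral_indic// setIT.
- by apply: (etrans (congr1 _ mJ)); rewrite -EFinM; congr EFin; ring.
- apply/measurable_EFinP; exact: measurable_indic.
Qed.

End Area.

(** * Caps and niches in oblique coordinates *)

Section Oblique.
Context {R : realType}.
Notation T2 := (measurableTypeR R * measurableTypeR R)%type.
Implicit Types (w s t : R) (q : R * R) (Theta : set R) (a b : R -> R).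

(** [cos w] times the product with [u_ t] of the point with oblique coordinates [q]; see
    [side_u_dot]. *)
Definition side_u w t q : R := q.1 * cos t - q.2 * sin (w - t).
(** The same for [v_ t]; see [side_v_dot]. *)
Definition side_v w t q : R := q.2 * cos (w - t) - q.1 * sin t.

(** The polygon cut out of the rhombus by prescribed support numbers, in the coordinates where the
    rhombus is the unit square. *)
Definition obl_cap w Theta a b : set (R * R) :=
  [set q | [/\ 0 <= q.1 <= 1, 0 <= q.2 <= 1 &
    forall t, Theta t -> side_u w t q <= cos w * a t /\ side_v w t q <= cos w * b t]].

Definition obl_niche w Theta a b : set (R * R) :=
  [set q | [/\ 0 <= q.1, 0 <= q.2 &
    exists2 t, Theta t & side_u w t q < cos w * (a t - 1) /\ side_v w t q < cos w * (b t - 1)]].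

(** For an angle [t] up to [w], neither [t] nor [w - t] exceeds [w], so [cos w] is a positive lower
    bound for both cosines. *)
Lemma trig_bounds w t : 0 < w < pi / 2 -> 0 <= t <= w ->
  [/\ 0 < cos w, cos w <= cos t <= 1, cos w <= cos (w - t) <= 1, 0 <= sin t <= 1 & 0 <= sin (w - t) <= 1].
Proof.
move=> /andP[w0 wpi] /andP[t0 tw]; have p0 := pi_gt0 R.
have cw : 0 < cos w by apply: cos_gt0_pihalf; lra.
have cmono x : 0 <= x <= w -> cos w <= cos x.
  move=> xw; case: (ltgtP x w) => [xw'|?|->]//; last by lra.
  by apply/ltW; rewrite ltr_cos ?in_itv /=; lra.
by rewrite !cos_le1 !sin_le1 !cmono ?sin_ge0_pi //=; lra.
Qed.

Lemma measurable_side (h : R * R -> R) x y k (z : R) : (forall q, h q = x * q.1 + y * q.2 + k) ->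
  measurable ([set q | h q <= z] : set T2) /\ measurable ([set q | h q < z] : set T2).
Proof.
move=> hE; split.
- have -> : [set q | h q <= z] = (fun q : T2 => x * q.1 + y * q.2 + k : measurableTypeR R) @^-1` `]-oo, z].
    by apply/seteqP; split => q /=; rewrite in_itv /= hE.
  by rewrite -[X in measurable X]setTI; apply: measurable_fun_affine.
- have -> : [set q | h q < z] = (fun q : T2 => x * q.1 + y * q.2 + k : measurableTypeR R) @^-1` `]-oo, z[.
    by apply/seteqP; split => q /=; rewrite in_itv /= hE.
  by rewrite -[X in measurable X]setTI; apply: measurable_fun_affine.
Qed.

Definition translate (e1 e2 : R) q : R * R := (q.1 + e1, q.2 + e2).

Lemma measurable_translate e1 e2 (X : set T2) : measurable X ->
  measurable (translate e1 e2 @^-1` X : set T2).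
Proof.
move=> mX; rewrite -[X in measurable X]setTI.
suff : measurable_fun setT (translate e1 e2 : T2 -> T2) by apply.
apply: measurable_fun_pair.
  by apply: measurable_funD => //; exact: measurable_fst.
by apply: measurable_funD => //; exact: measurable_snd.
Qed.

Lemma measurable_obl_cap w Theta a b : finite_set Theta -> measurable (obl_cap w Theta a b : set T2).
Proof.
move=> fT.
have -> : obl_cap w Theta a b =
  [set q | -1 * q.1 <= 0] `&` [set q | q.1 <= 1] `&` [set q | -1 * q.2 <= 0] `&` [set q | q.2 <= 1]
  `&` \bigcap_(t in Theta) ([set q | side_u w t q <= cos w * a t] `&` [set q | side_v w t q <= cos w * b t]).
  apply/seteqP; split => q /=.
    move=> [/andP[? ?] /andP[? ?] h]; split; last by move=> t /h[].
    repeat split => //; lra.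
  move=> [[[[? ?] ?] ?] h]; split; [lra|lra|].
  by move=> t /h [].
apply: measurableI; last first.
  apply: fin_bigcap_measurable => // t _; apply: measurableI.
    by apply: (proj1 (@measurable_side _ (cos t) (- sin (w - t)) 0 _ _)) => q; rewrite /side_u; ring.
  by apply: (proj1 (@measurable_side _ (- sin t) (cos (w - t)) 0 _ _)) => q; rewrite /side_v; ring.
repeat apply: measurableI.
- by apply: (proj1 (@measurable_side _ (-1) 0 0 _ _)) => q; ring.
- by apply: (proj1 (@measurable_side _ 1 0 0 _ _)) => q; ring.
- by apply: (proj1 (@measurable_side _ 0 (-1) 0 _ _)) => q; ring.
- by apply: (proj1 (@measurable_side _ 0 1 0 _ _)) => q; ring.
Qed.

Lemma measurable_obl_niche w Theta a b : finite_set Theta -> measurable (obl_niche w Theta a b : set T2).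
Proof.
move=> fT.
have -> : obl_niche w Theta a b =
  [set q | -1 * q.1 <= 0] `&` [set q | -1 * q.2 <= 0]
  `&` \bigcup_(t in Theta) ([set q | side_u w t q < cos w * (a t - 1)] `&` [set q | side_v w t q < cos w *
    (b t - 1)]).
  apply/seteqP; split => q /=.
    move=> [? ? [t Tt h]]; split; last by exists t.
    split; lra.
  move=> [[? ?] [t Tt h]]; split; [lra|lra|].
  by exists t.
apply: measurableI; last first.
  apply: fin_bigcup_measurable => // t _; apply: measurableI.
    by apply: (proj2 (@measurable_side _ (cos t) (- sin (w - t)) 0 _ _)) => q; rewrite /side_u; ring.
  by apply: (proj2 (@measurable_side _ (- sin t) (cos (w - t)) 0 _ _)) => q; rewrite /side_v; ring.
apply: measurableI.
- by apply: (proj1 (@measurable_side _ (-1) 0 0 _ _)) => q; ring.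
- by apply: (proj1 (@measurable_side _ 0 (-1) 0 _ _)) => q; ring.
Qed.

Definition box (i j : bool) (x y u v : R) : set (R * R) :=
  [set q | (q.1 \in Interval (BSide i x) (BSide j y)) /\ (q.2 \in Interval (BSide i u) (BSide j v))].

Lemma measurable_box i j x y u v : measurable (box i j x y u v : set T2).
Proof.
have -> : box i j x y u v = [set` Interval (BSide i x) (BSide j y)] `*` [set` Interval (BSide i u)
  (BSide j v)] by [].
by apply: measurableX.
Qed.

(** [M] and [MN] are the perturbed cap [K'] and niche [N'] carried back to the original position.
    The common parts of old and new are finite and cancel, which leaves the gains [G1], [G2], the
    losses [Lo1], [Lo2] and the new pieces of niche [Ni1], [Ni2]. *)
Lemma exchange_measure d (T : measurableType d) (nu : {measure set T -> \bar R})
    (K M K' N MN N' G1 G2 Lo1 Lo2 Ni1 Ni2 : set T) (g1 g2 l1 l2 n1 n2 : R) :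
  measurable K -> measurable M -> measurable N -> measurable MN ->
  measurable G1 -> measurable G2 -> measurable Lo1 -> measurable Lo2 ->
  measurable Ni1 -> measurable Ni2 ->
  (nu K < +oo)%E -> (nu N < +oo)%E ->
  nu K' = nu M -> nu N' = nu MN ->
  nu G1 = g1%:E -> nu G2 = g2%:E -> nu Lo1 = l1%:E -> nu Lo2 = l2%:E ->
  nu Ni1 = n1%:E -> nu Ni2 = n2%:E ->
  G1 `<=` M -> G2 `<=` M -> G1 `&` K = set0 -> G2 `&` (K `|` G1) = set0 ->
  K `\` M `<=` Lo1 `|` Lo2 -> MN `<=` N `|` (Ni1 `|` Ni2) ->
  (nu K' + nu N <= nu K + nu N')%E ->
  g1 + g2 <= l1 + l2 + n1 + n2.
Proof.
move=> mK mM mN mMN mG1 mG2 mL1 mL2 mN1 mN2 fK fN eK eN eG1 eG2 eL1 eL2 eN1 eN2 G1M G2M d1 d2 KL MNN.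
have mI : measurable (K `&` M) by exact: measurableI.
have fI : (nu (K `&` M) < +oo)%E.
  by apply: le_lt_trans fK; apply: le_measure; rewrite ?inE//; exact: subIsetl.
have hM : (nu (K `&` M) + g1%:E + g2%:E <= nu M)%E.
  rewrite -eG1 -eG2 -measureU//; last first.
    by rewrite -subset0 -d1 => x [[? ?] ?].
  rewrite -measureU//.
  - apply: le_measure; rewrite ?inE//; first by apply: measurableU => //; exact: measurableU.
    by move=> x [[[]|/G1M]|/G2M].
  - by apply: measurableU.
  - by rewrite -subset0 -d2 => x [[[? ?]|?] ?]; split => //; [left|right].
have hK : (nu K <= nu (K `&` M) + (l1%:E + l2%:E))%E.
  rewrite -eL1 -eL2.
  apply: (@le_trans _ _ (nu ((K `&` M) `|` (Lo1 `|` Lo2)))).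
    apply: le_measure; rewrite ?inE//; first by apply: measurableU => //; exact: measurableU.
    move=> x Kx; have [Mx|nMx] := pselect (M x); first by left.
    by right; apply: KL.
  apply: (le_trans (measureU2 _ _ _)) => //; first exact: measurableU.
  by apply: leeD => //; exact: measureU2.
have hN : (nu MN <= nu N + (n1%:E + n2%:E))%E.
  rewrite -eN1 -eN2.
  apply: (@le_trans _ _ (nu (N `|` (Ni1 `|` Ni2)))).
    by apply: le_measure; rewrite ?inE//; apply: measurableU => //; exact: measurableU.
  apply: (le_trans (measureU2 _ _ _)) => //; first exact: measurableU.
  by apply: leeD => //; exact: measureU2.
have kI : nu (K `&` M) \is a fin_num by rewrite ge0_fin_numE.
have kN : nu N \is a fin_num by rewrite ge0_fin_numE.
rewrite eK eN => hmax.
have : (nu (K `&` M) + g1%:E + g2%:E + nu N <= nu (K `&` M) + (l1%:E + l2%:E) + (nu N + (n1%:E + n2%:E)))%E.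
  apply: (@le_trans _ _ (nu M + nu N)%E); first exact: leeD.
  by apply: (le_trans hmax); exact: leeD.
rewrite -(fineK kI) -(fineK kN) -!EFinD lee_fin => h.
lra.
Qed.

End Oblique.

(** * Translating the sides of a cap *)

(** Chooses the direction of the translation: [s] is the last angle at which the slack [f]
    vanishes, and beyond it the slack has a positive lower bound, as there are finitely many angles. *)
Lemma exists_last_zero {R : realType} (Theta : set R) (f : R -> R) : finite_set Theta ->
  (forall t, Theta t -> 0 < t /\ 0 <= f t) ->
  exists s, [/\ 0 <= s, s = 0 \/ (Theta s /\ f s = 0) &
    exists2 m, 0 < m & forall t, Theta t -> s < t -> m <= f t].
Proof.
move=> /finite_seqP[l ->]; elim: l => [|x l IH] hl.
  by exists 0; split => //; [left|exists 1].
have [t tl|s [s0 hs [m m0 hm]]] := IH; first by apply: hl; rewrite /= inE; apply/orP; right.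
have [x0 fx0] : 0 < x /\ 0 <= f x by apply: hl; rewrite /= inE eqxx.
have [fx|fx] := eqVneq (f x) 0; last first.
  exists s; split => //; first by case: hs => [->|[ls fs]]; [left|right; rewrite /= inE; split=> //;
    apply/orP; right].
  exists (Num.min m (f x)); first by rewrite lt_min m0 lt_def fx fx0.
  move=> t; rewrite /= inE => /orP[/eqP -> _|tl st]; rewrite ge_min ?lexx ?orbT//.
  by rewrite hm.
have [sx|xs] := ltP s x.
  exists x; split; [lra|by right; rewrite /= inE eqxx|].
  exists m => // t; rewrite /= inE => /orP[/eqP -> |tl xt]; first by rewrite ltxx.
  by apply: hm => //; lra.
exists s; split => //; first by case: hs => [->|[ls fs]]; [left|right; rewrite /= inE; split=> //;
  apply/orP; right].
exists m => // t; rewrite /= inE => /orP[/eqP -> |tl st]; first by lra.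
exact: hm.
Qed.

Section Inclusions.
Context {R : realType}.
Implicit Types (w s t : R) (q : R * R) (Theta : set R) (a b : R -> R).

(** The support numbers after the sides have been translated by the vector with oblique coordinates
    [(e1, e2)]. *)
Definition shift_a w (e1 e2 : R) a t := a t + (e1 * cos t - e2 * sin (w - t)) / cos w.
Definition shift_b w (e1 e2 : R) b t := b t + (e2 * cos (w - t) - e1 * sin t) / cos w.

Lemma shift_aE w e1 e2 a t : 0 < cos w ->
  cos w * shift_a w e1 e2 a t = cos w * a t + (e1 * cos t - e2 * sin (w - t)).
Proof. by move=> c0; rewrite /shift_a; field; lra. Qed.

Lemma shift_bE w e1 e2 b t : 0 < cos w ->
  cos w * shift_b w e1 e2 b t = cos w * b t + (e2 * cos (w - t) - e1 * sin t).
Proof. by move=> c0; rewrite /shift_b; field; lra. Qed.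

Lemma obl_cap_shift w Theta a b e1 e2 q : 0 < cos w ->
  obl_cap w Theta (shift_a w e1 e2 a) (shift_b w e1 e2 b) (q.1 + e1, q.2 + e2) <->
  [/\ 0 <= q.1 + e1 <= 1, 0 <= q.2 + e2 <= 1 &
    forall t, Theta t -> side_u w t q <= cos w * a t /\ side_v w t q <= cos w * b t].
Proof.
move=> c0; split=> -[h1 h2 h3]; split => // t /h3;
  rewrite shift_aE// shift_bE// /side_u /side_v /=; lra.
Qed.

Lemma obl_niche_shift w Theta a b e1 e2 q : 0 < cos w ->
  obl_niche w Theta (shift_a w e1 e2 a) (shift_b w e1 e2 b) (q.1 + e1, q.2 + e2) ->
  [/\ 0 <= q.1 + e1, 0 <= q.2 + e2 & exists2 t, Theta t &
    side_u w t q < cos w * (a t - 1) /\ side_v w t q < cos w * (b t - 1)].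
Proof.
move=> c0 [h1 h2 [t Tt]]; rewrite !mulrBr !mulr1 shift_aE// shift_bE// /side_u /side_v /= => h.
by split => //; exists t => //; rewrite /side_u /side_v; lra.
Qed.

(** Leaving the rhombus through the lower left edge by [- x] can push a point out of the polygon
    only past the tip, and a margin [d] at the tip makes up for it. *)
Lemma gain_side (c ct ce st se x y rho La d A B : R) :
  0 < c -> c <= ct <= 1 -> c <= ce <= 1 -> 0 <= st <= 1 -> 0 <= se <= 1 ->
  0 <= rho -> 0 <= La -> rho * ct <= A -> La * ce <= B ->
  x <= 0 -> - x <= d * c -> 0 <= y <= La - d ->
  x * ct - y * se <= A /\ y * ce - x * st <= B.
Proof.
move=> c0 hct hce hst hse r0 L0 hA hB x0 xd hy; split.
  have : x * ct <= 0 by nra.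
  have : 0 <= y * se by nra.
  have : 0 <= rho * ct by nra.
  lra.
have d0 : 0 <= d by nra.
have h5 : d * c <= d * ce by nra.
have h6 : (y + d - La) * ce <= 0 by nra.
have h7 : - x * st <= d * c by nra.
lra.
Qed.

(** The two inequalities of an inner quadrant, combined with coefficients that eliminate one
    coordinate. On the far side of an edge of the rhombus the eliminated coordinate has a sign, which
    gives the sharper bounds by [rho] and [Bd]. *)
Lemma niche_bound (c ct ce st se x y rho Bd A B : R) :
  0 < c -> c <= ct <= 1 -> c <= ce <= 1 -> 0 <= st <= 1 -> 0 <= se <= 1 ->
  c = ct * ce - st * se -> 0 <= rho -> 0 <= Bd -> A <= rho * ct -> B <= Bd * ce ->
  x * ct - y * se < A -> y * ce - x * st < B ->
  [/\ x * c <= rho + Bd, y * c <= rho + Bd, (y <= 0 -> x < rho) & (x <= 0 -> y < Bd)].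
Proof.
move=> c0 hct hce hst hse cE r0 B0 hA hB h1 h2.
have k1 : A <= rho by nra.
have k2 : B <= Bd by nra.
split.
- have -> : x * c = ce * (x * ct - y * se) + se * (y * ce - x * st) by rewrite cE; ring.
  have : ce * (x * ct - y * se) <= rho.
    have : ce * (x * ct - y * se) <= ce * rho by rewrite ler_pM2l; lra.
    nra.
  have : se * (y * ce - x * st) <= se * Bd by apply: ler_wpM2l; lra.
  have : se * Bd <= Bd by nra.
  lra.
- have -> : y * c = st * (x * ct - y * se) + ct * (y * ce - x * st) by rewrite cE; ring.
  have : ct * (y * ce - x * st) <= Bd.
    have : ct * (y * ce - x * st) <= ct * Bd by rewrite ler_pM2l; lra.
    nra.
  have : st * (x * ct - y * se) <= st * rho by apply: ler_wpM2l; lra.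
  have : st * rho <= rho by nra.
  lra.
- move=> y0; have h : x * ct < rho * ct by nra.
  by rewrite ltr_pM2r in h; lra.
- move=> x0; have h : y * ce < Bd * ce by nra.
  by rewrite ltr_pM2r in h; lra.
Qed.

(** The supporting line of angle [t1] bounds from below the part of the cap within [e1] of the upper
    right side. *)
Lemma loss_low (e1 x y ct se H : R) : 0 <= ct -> 0 < se -> 1 - e1 <= x ->
  x * ct - y * se <= H -> ((1 - e1) * ct - H) / se <= y.
Proof. by move=> c0 s0 hx h; rewrite ler_pdivrMr//; nra. Qed.

Lemma loss_corner (ce st x y e : R) : 0 < st -> ce <= 1 -> 0 <= ce -> y <= 1 -> 1 - e * st <= y ->
  y * ce - x * st <= ce - st -> 1 - e <= x.
Proof.
move=> s0 c1 c0 y1 hy h.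
have : (1 - x) * st <= e * st by nra.
by rewrite ler_pM2r//; lra.
Qed.

Lemma trig_in w Theta t : 0 < w < pi / 2 -> Theta `<=` `]0, w[ -> Theta t ->
  [/\ cos w <= cos t <= 1, cos w <= cos (w - t) <= 1, 0 <= sin t <= 1 & 0 <= sin (w - t) <= 1].
Proof.
move=> hw sT /sT; rewrite /= in_itv /= => ht.
by have [] := @trig_bounds R w t hw ltac:(lra).
Qed.

Section Inclusion.
Variables (w : R) (Theta : set R) (a b : R -> R).
Hypotheses (hw : 0 < w < pi / 2) (sT : Theta `<=` `]0, w[).

Let cw0 : 0 < cos w.
Proof. by have [] := @trig_bounds R w 0 hw ltac:(have := hw; lra). Qed.

Lemma gain_left rho La d e1 e2 : 0 <= rho -> 0 <= e1 <= 1 -> 0 <= e2 <= d -> e1 <= d * cos w -> d <= La <= 1 ->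
  obl_cap w Theta a b (rho, 0) -> obl_cap w Theta a b (0, La) ->
  box true true (- e1) 0 0 (La - d) `<=`
  translate e1 e2 @^-1` obl_cap w Theta (shift_a w e1 e2 a) (shift_b w e1 e2 b).
Proof.
move=> r0 he1 he2 e1d dLa [_ _ hr] [_ _ hL] q.
rewrite /box /= !in_itv /= => -[h1 h2]; apply/obl_cap_shift => //; split; [lra|lra|].
move=> t Tt; have [h3 h4 h5 h6] := trig_in hw sT Tt.
have [h7 _] := hr _ Tt; have [_ h8] := hL _ Tt.
rewrite /side_u /side_v /= in h7 h8 *.
by apply: (@gain_side (cos w) _ _ _ _ _ _ rho La d) => //; lra.
Qed.

Lemma gain_right rho La d e1 e2 : 0 <= La -> 0 <= e2 <= 1 -> 0 <= e1 <= d -> e2 <= d * cos w -> d <= rho <= 1 ->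
  obl_cap w Theta a b (rho, 0) -> obl_cap w Theta a b (0, La) ->
  box true true 0 (rho - d) (- e2) 0 `<=`
  translate e1 e2 @^-1` obl_cap w Theta (shift_a w e1 e2 a) (shift_b w e1 e2 b).
Proof.
move=> r0 he1 he2 e1d dLa [_ _ hr] [_ _ hL] q.
rewrite /box /= !in_itv /= => -[h1 h2]; apply/obl_cap_shift => //; split; [lra|lra|].
move=> t Tt; have [h3 h4 h5 h6] := trig_in hw sT Tt.
have [h7 _] := hr _ Tt; have [_ h8] := hL _ Tt.
rewrite /side_u /side_v /= in h7 h8 *.
by apply/and_comm; apply: (@gain_side (cos w) _ _ _ _ _ _ La rho d) => //; lra.
Qed.

(** The translation moves two slabs of the cap out of the rhombus. The slab along the upper right
    side has first-order area, bounded by means of the supporting line of angle [t1]. The slab along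
    the top is empty when [s = 0]; otherwise the side through the corner confines it to a box of
    size [e] by [e2], of second order. *)
Lemma loss_subset s e t1 H : 0 <= e -> 0 <= s <= w -> 0 <= t1 < w ->
  (forall q, obl_cap w Theta a b q -> side_u w t1 q <= H) ->
  s = 0 \/ (Theta s /\ cos w * b s = side_v w s (1, 1)) ->
  let e1 := e * cos (w - s) in let e2 := e * sin s in
  obl_cap w Theta a b `\` translate e1 e2 @^-1` obl_cap w Theta (shift_a w e1 e2 a) (shift_b w e1 e2 b) `<=`
  box true false (1 - e1) 1 (((1 - e1) * cos t1 - H) / sin (w - t1)) 1 `|`
  box true false (1 - e) 1 (1 - e2) 1.
Proof.
move=> e0 hs ht1 HH tight e1 e2 q [Kq nM].
have [_ _ hCs hSs _] := trig_bounds hw hs.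
have e10 : 0 <= e1 by apply: mulr_ge0 => //; have := cw0; lra.
have e20 : 0 <= e2 by apply: mulr_ge0; lra.
have [h1 h2 h3] := Kq.
have [hl|hl] := ltP 1 (q.1 + e1).
  left; rewrite /box /= !in_itv /=; split; first by lra.
  apply/andP; split; last by lra.
  have hw' := hw; have p0 := pi_gt0 R.
  have [h4 h5 _ _ _] := @trig_bounds R w t1 hw ltac:(lra).
  apply: (@loss_low _ q.1); [lra| |lra|exact: HH].
  by apply: sin_gt0_pihalf; lra.
have [hr|hr] := ltP 1 (q.2 + e2).
  right; rewrite /box /= !in_itv /=; split; last by lra.
  case: tight => [s0|[Ts bs]]; first by move: hr; rewrite /e2 s0 sin0; lra.
  have [_] := h3 _ Ts; rewrite bs /side_v /= !mul1r => h4.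
  have ss0 : 0 < sin s.
    have hw' := hw; have p0 := pi_gt0 R.
    by have := sT Ts; rewrite /= in_itv /= => ?; apply: sin_gt0_pihalf; lra.
  apply/andP; split; last by lra.
  by apply: (@loss_corner (cos (w - s)) (sin s) q.1 q.2 e) => //; rewrite -/e2; have := cw0; lra.
by case: nM; apply/obl_cap_shift => //; split => //; lra.
Qed.

(** The translated inner quadrants leave the old niche only in slabs along the two lower edges. There
    the quadrants reach at most [Bd] and [rho]. *)
Lemma niche_subset rho Bd e1 e2 : 0 <= rho -> 0 <= Bd -> 0 <= e1 -> 0 <= e2 ->
  (forall t, Theta t -> cos w * (a t - 1) <= rho * cos t) ->
  (forall t, Theta t -> cos w * (b t - 1) <= Bd * cos (w - t)) ->
  translate e1 e2 @^-1` obl_niche w Theta (shift_a w e1 e2 a) (shift_b w e1 e2 b) `<=`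
  obl_niche w Theta a b `|` (box true false (- e1) 0 (- e2) Bd `|` box true false (- e1) rho (- e2) 0).
Proof.
move=> r0 B0 e10 e20 Ha Hb q /obl_niche_shift -/(_ cw0) [h1 h2 [t Tt [hA hB]]].
have [hCt hCe hSt hSe] := trig_in hw sT Tt.
have cE : cos w = cos t * cos (w - t) - sin t * sin (w - t) by rewrite -cosD; congr cos; ring.
have [_ _ hx hy] := niche_bound cw0 hCt hCe hSt hSe cE r0 B0 (Ha _ Tt) (Hb _ Tt) hA hB.
have [q1|q1] := ltP q.1 0.
  by right; left; rewrite /box /= !in_itv /=; have := hy (ltW q1); lra.
have [q2|q2] := ltP q.2 0.
  by right; right; rewrite /box /= !in_itv /=; have := hx (ltW q2); lra.
by left; split => //; exists t.
Qed.

Lemma niche_bounded rho Bd : 0 <= rho -> 0 <= Bd ->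
  (forall t, Theta t -> cos w * (a t - 1) <= rho * cos t) ->
  (forall t, Theta t -> cos w * (b t - 1) <= Bd * cos (w - t)) ->
  obl_niche w Theta a b `<=` box true false 0 ((rho + Bd) / cos w) 0 ((rho + Bd) / cos w).
Proof.
move=> r0 B0 Ha Hb q [h1 h2 [t Tt [hA hB]]].
have [hCt hCe hSt hSe] := trig_in hw sT Tt.
have cE : cos w = cos t * cos (w - t) - sin t * sin (w - t) by rewrite -cosD; congr cos; ring.
have [hx hy _ _] := niche_bound cw0 hCt hCe hSt hSe cE r0 B0 (Ha _ Tt) (Hb _ Tt) hA hB.
by rewrite /box /= !in_itv /= h1 h2 !ler_pdivlMr.
Qed.

(** The translation is along [u_ s], which makes an acute angle with every [u_ t]. *)
Lemma shift_u_ge0 s e t : 0 <= s < w -> 0 <= e -> Theta t ->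
  0 <= e * cos (w - s) * cos t - e * sin s * sin (w - t).
Proof.
move=> hs e0 /sT; rewrite /= in_itv /= => ht; have hw' := hw.
have -> : e * cos (w - s) * cos t - e * sin s * sin (w - t) = e * cos w * cos (s - t).
  by rewrite !cosB sinB; ring.
apply: mulr_ge0; first by apply: mulr_ge0 => //; exact: ltW.
by apply: cos_ge0_pihalf; lra.
Qed.

(** The polygon touches both upper sides of the rhombus because the corner stays in it. *)
Lemma shifted_corner s e e1 e2 : e1 = e * cos (w - s) -> e2 = e * sin s ->
  0 <= s < w -> 0 <= e -> 0 <= e1 -> 0 <= e2 -> e1 <= 1 -> e2 <= 1 ->
  obl_cap w Theta a b (1, 1) ->
  (forall t, Theta t -> side_v w t (1 - e1, 1 - e2) <= cos w * b t) ->
  obl_cap w Theta (shift_a w e1 e2 a) (shift_b w e1 e2 b) (1, 1).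
Proof.
move=> e1E e2E hs e0 e10 e20 e11 e21 [_ _ K11] slack.
have := @obl_cap_shift w Theta a b e1 e2 (1 - e1, 1 - e2) cw0.
rewrite /= !subrK => h; apply/h; split; [lra|lra|] => t Tt; split; last exact: slack.
have [h1 _] := K11 _ Tt; apply: le_trans h1.
by have := shift_u_ge0 hs e0 Tt; rewrite -e1E -e2E /side_u /=; lra.
Qed.

Lemma shifted_origin s e e1 e2 rho La : e1 = e * cos (w - s) -> e2 = e * sin s ->
  0 <= s < w -> 0 <= e -> 0 <= e1 <= e -> 0 <= e2 -> e <= 1 -> e2 <= 1 ->
  0 <= rho -> 0 <= La -> e <= cos w * La ->
  obl_cap w Theta a b (rho, 0) -> obl_cap w Theta a b (0, La) ->
  obl_cap w Theta (shift_a w e1 e2 a) (shift_b w e1 e2 b) (0, 0).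
Proof.
move=> e1E e2E hs e0 /andP[e10 e1e] e20 e11 e21 rho0 La0 eLa [_ _ Kr] [_ _ KL].
have := @obl_cap_shift w Theta a b e1 e2 (- e1, - e2) cw0.
rewrite /= !addNr => h; apply/h; split; [lra|lra|] => t Tt.
have [hCt hCe hSt hSe] := trig_in hw sT Tt; have c0 := cw0.
have [h1 _] := Kr _ Tt; have [_ h2] := KL _ Tt; have := shift_u_ge0 hs e0 Tt.
rewrite -e1E -e2E; rewrite /side_u /side_v /= in h1 h2 * => h3; split.
  have : 0 <= rho * cos t by rewrite mulr_ge0//; lra.
  lra.
have : e1 * sin t <= e1 by rewrite ler_piMr//; lra.
have : 0 <= e2 * cos (w - t) by rewrite mulr_ge0//; lra.
have : La * cos w <= La * cos (w - t) by apply: ler_wpM2l => //; lra.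
lra.
Qed.

End Inclusion.
End Inclusions.

(** * The first-order balance of a maximum cap *)

(** The left-hand side exceeds the right-hand side by [e1] times the quantity assumed positive, up to
    terms of order [e ^ 2]; the terms in [rho] cancel. *)
Lemma first_order_absurd {R : realType} (c ct ci si La rho Y Bd e e1 e2 : R) :
  0 < e -> 0 < c -> c <= 1 -> 0 < ci -> 0 < si -> 0 <= ct <= 1 ->
  0 < La - (1 - Y) - Bd -> e * c <= e1 -> 0 <= e2 -> e1 <= e -> e2 <= e -> 0 < e1 ->
  e * (2 * ci + si + 3) <= c * (La - (1 - Y) - Bd) / 2 ->
  e1 * (La - e * ci) + e2 * (rho - e * ci) <=
  e1 * (1 - (Y - e1 * ct * si)) + e * e2 + e1 * (Bd + e2) + (rho + e1) * e2 -> False.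
Proof.
move=> e0 c0 c1 ci0 si0 hct; set X := La - (1 - Y) - Bd => X0 e10 e20 e1e e2e e1p eC main.
have m1 : e1 * X <= e1 * (e * ci) + e2 * (e * ci) + e1 * (e1 * ct * si) + e * e2 + 2 * (e1 * e2).
  rewrite /X; lra.
move: main eC X0; rewrite -/X; move: X m1 => X m1 _ eC X0.
have eci : 0 < e * ci by rewrite mulr_gt0.
have esi : 0 < e * si by rewrite mulr_gt0.
have m2 : e1 * (e * ci) <= e * (e * ci) by rewrite ler_pM2r.
have m3 : e2 * (e * ci) <= e * (e * ci) by rewrite ler_pM2r.
have m4 : e1 * (e1 * ct * si) <= e * (e * si).
  have h1 : e1 * ct <= e by nra.
  have h2 : e1 * ct * si <= e * si by rewrite ler_pM2r.
  nra.
have m5 : e * e2 + 2 * (e1 * e2) <= e * (3 * e) by nra.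
have m6 : e * c * X <= e1 * X by rewrite ler_pM2r.
have m7 : c * X <= e * (2 * ci + si + 3) by rewrite -(ler_pM2l e0); lra.
have : 0 < c * X by rewrite mulr_gt0.
lra.
Qed.

Section Exchange.
Context {R : realType}.
Notation T2 := (measurableTypeR R * measurableTypeR R)%type.

Lemma exchange_boxes (nu : {measure set T2 -> \bar R}) (kappa : R)
    (K M K' N MN N' : set (R * R)) (e e1 e2 d La rho Y Bd : R) :
  0 < kappa ->
  (forall i j (x y u v : R), x <= y -> u <= v ->
     nu (box i j x y u v) = (kappa * ((y - x) * (v - u)))%:E) ->
  measurable (K : set T2) -> measurable (M : set T2) ->
  measurable (N : set T2) -> measurable (MN : set T2) ->
  K `<=` box true false 0 1 0 1 -> (nu N < +oo)%E ->
  nu K' = nu M -> nu N' = nu MN ->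
  0 <= e -> 0 <= e1 -> 0 <= e2 -> d <= La -> d <= rho -> Y <= 1 -> 0 <= Bd -> 0 <= rho ->
  box true true (- e1) 0 0 (La - d) `<=` M -> box true true 0 (rho - d) (- e2) 0 `<=` M ->
  K `\` M `<=` box true false (1 - e1) 1 Y 1 `|` box true false (1 - e) 1 (1 - e2) 1 ->
  MN `<=` N `|` (box true false (- e1) 0 (- e2) Bd `|` box true false (- e1) rho (- e2) 0) ->
  (nu K' + nu N <= nu K + nu N')%E ->
  e1 * (La - d) + e2 * (rho - d) <=
  e1 * (1 - Y) + e * e2 + e1 * (Bd + e2) + (rho + e1) * e2.
Proof.
move=> k0 nu_box mK mM mN mMN Ksq fN eK eN e0 e10 e20 dLa drho Y1 Bd0 rho0 G1 G2 Lo Ni hmax.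
have mr i j x y u v := @measurable_box R i j x y u v.
have fK : (nu K < +oo)%E.
  apply: (@le_lt_trans _ _ (nu (box true false 0 1 0 1))); last by rewrite nu_box ?ltry.
  by apply: le_measure; rewrite ?inE.
have d1 : box true true (- e1) 0 0 (La - d) `&` K = set0.
  rewrite -subset0 => q [+ /Ksq]; rewrite /box /= !in_itv /= => -[/andP[_ h1] _] [/andP[h2 _] _].
  by move: (lt_le_trans h1 h2); rewrite ltxx.
have d2 : box true true 0 (rho - d) (- e2) 0 `&` (K `|` box true true (- e1) 0 0 (La - d)) = set0.
  rewrite -subset0 => q [+ [/Ksq|]]; rewrite /box /= !in_itv /=.
    move=> -[_ /andP[_ h1]] [_ /andP[h2 _]].
    by move: (lt_le_trans h1 h2); rewrite ltxx.
  move=> -[/andP[h1 _] _] [/andP[_ h2] _].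
  by move: (le_lt_trans h1 h2); rewrite ltxx.
have [p1 p2] : - e1 <= 0 /\ - e2 <= 0 by rewrite !oppr_le0.
have [p3 p4] : 0 <= La - d /\ 0 <= rho - d by rewrite !subr_ge0.
have [p5 p6] : - e1 <= rho /\ - e2 <= Bd by split; [exact: le_trans rho0|exact: le_trans Bd0].
have [p7 p8 p9] : [/\ 1 - e1 <= 1, 1 - e2 <= 1 & 1 - e <= 1] by rewrite !gerBl.
have h := exchange_measure mK mM mN mMN (mr _ _ _ _ _ _) (mr _ _ _ _ _ _) (mr _ _ _ _ _ _)
  (mr _ _ _ _ _ _) (mr _ _ _ _ _ _) (mr _ _ _ _ _ _) fK fN eK eN
  (nu_box _ _ _ _ _ _ p1 p3) (nu_box _ _ _ _ _ _ p4 p2) (nu_box _ _ _ _ _ _ p7 Y1)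
  (nu_box _ _ _ _ _ _ p9 p8) (nu_box _ _ _ _ _ _ p1 p6) (nu_box _ _ _ _ _ _ p5 p2) G1 G2 d1 d2 Lo Ni hmax.
rewrite -(ler_pM2l k0); lra.
Qed.

End Exchange.

Lemma shift_sizes {R : realType} (w s e e1 e2 : R) : 0 < w < pi / 2 -> 0 <= s < w -> 0 < e ->
  e1 = e * cos (w - s) -> e2 = e * sin s ->
  [/\ 0 < cos w, cos w <= 1 & [/\ 0 <= e1, 0 <= e2, e1 <= e & e2 <= e]].
Proof.
move=> hw hs e0 -> ->.
have [c0 _ hc hsn _] := @trig_bounds R w s hw ltac:(lra).
have c1 := cos_le1 w; split => //.
split; [apply: mulr_ge0; lra|apply: mulr_ge0; lra| |]; rewrite ler_piMr//; lra.
Qed.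

Lemma quotient_sizes {R : realType} (c e La rho : R) : 0 < c -> c <= 1 -> 0 < e ->
  e <= c * La -> e <= c * rho ->
  [/\ 0 <= e / c, e <= e / c & [/\ e = e / c * c, e / c <= La & e / c <= rho]].
Proof.
move=> c0 c1 e0 eLa erho; have ee : e = e / c * c by rewrite divfK//; lra.
have d0 : 0 <= e / c by rewrite divr_ge0//; lra.
split => //; first by rewrite {1}ee ler_piMr.
by split => //; rewrite ler_pdivrMr// mulrC.
Qed.

Section Variation.
Context {R : realType}.
Notation T2 := (measurableTypeR R * measurableTypeR R)%type.
Variables (w : R) (Theta : set R) (a b : R -> R).
Hypotheses (hw : 0 < w < pi / 2) (fT : finite_set Theta) (sT : Theta `<=` `]0, w[).
Variables (nu : {measure set T2 -> \bar R}) (kappa : R).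
Hypotheses (k0 : 0 < kappa)
  (nu_shift : forall (e1 e2 : R) (X : set T2), measurable X ->
     nu (translate e1 e2 @^-1` X) = nu X)
  (nu_box : forall i j (x y u v : R), x <= y -> u <= v ->
     nu (box i j x y u v) = (kappa * ((y - x) * (v - u)))%:E).
Variables (rho La Bd t1 H : R).
Hypotheses (K11 : obl_cap w Theta a b (1, 1)) (Krho : obl_cap w Theta a b (rho, 0))
  (KLa : obl_cap w Theta a b (0, La))
  (rho0 : 0 < rho) (La0 : 0 < La) (Bd0 : 0 <= Bd)
  (Ha : forall t, Theta t -> cos w * (a t - 1) <= rho * cos t)
  (Hb : forall t, Theta t -> cos w * (b t - 1) <= Bd * cos (w - t))
  (t1w : 0 <= t1 < w) (HH : forall q, obl_cap w Theta a b q -> side_u w t1 q <= H)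
  (Hmax : forall a' b', obl_cap w Theta a' b' (1, 1) -> obl_cap w Theta a' b' (0, 0) ->
    (nu (obl_cap w Theta a' b') + nu (obl_niche w Theta a b)
     <= nu (obl_cap w Theta a b) + nu (obl_niche w Theta a' b'))%E).

Let t1w_le : 0 <= t1 <= w.
Proof. by case/andP: t1w => -> /ltW. Qed.

Let sin_t1_gt0 : 0 < sin (w - t1).
Proof. by have hw' := hw; have t1w' := t1w; have p0 := pi_gt0 R; apply: sin_gt0_pihalf; lra. Qed.

(** Maximality compared with the cap and niche whose sides are translated by [e] along [u_ s]. *)
Lemma translate_variation (s e e1 e2 : R) : e1 = e * cos (w - s) -> e2 = e * sin s ->
  0 <= s < w -> 0 < e -> e <= cos w * La -> e <= cos w * rho ->
  (forall t, Theta t -> side_v w t (1 - e1, 1 - e2) <= cos w * b t) ->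
  s = 0 \/ (Theta s /\ cos w * b s = side_v w s (1, 1)) ->
  e1 * (La - e / cos w) + e2 * (rho - e / cos w) <=
  e1 * (1 - ((1 - e1) * cos t1 - H) / sin (w - t1)) + e * e2 + e1 * (Bd + e2) + (rho + e1) * e2.
Proof.
move=> e1E e2E hs e0 eLa erho slack tight.
have [rho1 La1] : rho <= 1 /\ La <= 1.
  by have [/andP[_ h1] _ _] := Krho; have [_ /andP[_ h2] _] := KLa.
have [c0 c1 [e10 e20 e1e e2e]] := shift_sizes hw hs e0 e1E e2E.
have e0' := ltW e0; have rho0' := ltW rho0; have La0' := ltW La0.
have [d0 ed [ecw dLa drho]] := quotient_sizes c0 c1 e0 eLa erho.
have le1 (x : R) : x <= e -> x <= 1.
  by move=> xe; apply: (le_trans xe); apply: (le_trans ed); exact: le_trans La1.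
have [i1 i2] : 0 <= e1 <= 1 /\ 0 <= e2 <= 1 by rewrite e10 e20 !le1.
have [j1 j2] : 0 <= e1 <= e / cos w /\ 0 <= e2 <= e / cos w.
  by rewrite e10 e20 (le_trans e1e ed) (le_trans e2e ed).
have [k1 k2] : e1 <= e / cos w * cos w /\ e2 <= e / cos w * cos w by rewrite -ecw.
have [l1 l2] : e / cos w <= La <= 1 /\ e / cos w <= rho <= 1 by rewrite dLa drho La1 rho1.
apply: (@exchange_boxes R nu kappa (obl_cap w Theta a b)
    (translate e1 e2 @^-1` obl_cap w Theta (shift_a w e1 e2 a) (shift_b w e1 e2 b))
    (obl_cap w Theta (shift_a w e1 e2 a) (shift_b w e1 e2 b))
    (obl_niche w Theta a b)
    (translate e1 e2 @^-1` obl_niche w Theta (shift_a w e1 e2 a) (shift_b w e1 e2 b))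
    (obl_niche w Theta (shift_a w e1 e2 a) (shift_b w e1 e2 b))
    e e1 e2 (e / cos w) La rho (((1 - e1) * cos t1 - H) / sin (w - t1)) Bd k0 nu_box) => //.
- exact: measurable_obl_cap.
- by apply: measurable_translate; exact: measurable_obl_cap.
- exact: measurable_obl_niche.
- by apply: measurable_translate; exact: measurable_obl_niche.
- by move=> q [h1 h2 _]; rewrite /box /= !in_itv /=.
- have B0 : 0 <= (rho + Bd) / cos w by rewrite divr_ge0 ?addr_ge0// ltW.
  apply: (@le_lt_trans _ _ (nu (box true false 0 ((rho + Bd) / cos w) 0 ((rho + Bd) / cos w))));
    last by rewrite nu_box ?ltry.
  apply: le_measure; rewrite ?inE//; [exact: measurable_obl_niche|exact: measurable_box|].
  exact: niche_bounded.
- by apply/esym; apply: nu_shift; exact: measurable_obl_cap.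
- by apply/esym; apply: nu_shift; exact: measurable_obl_niche.
- apply: (@loss_low _ _ 1); [|exact: sin_t1_gt0| |exact: (HH K11)].
    by have [_ /andP[h _] _ _ _] := @trig_bounds R w t1 hw t1w_le; apply: le_trans h; exact: ltW.
  by rewrite gerBl.
- exact: (gain_left hw sT rho0' i1 j2 k1 l1 Krho KLa).
- exact: (gain_right hw sT La0' i2 j1 k2 l2 Krho KLa).
- by rewrite e1E e2E; apply: loss_subset => //; case/andP: hs => -> /ltW.
- exact: niche_subset.
- apply: Hmax.
    by apply: (shifted_corner hw sT e1E e2E) => //; exact: le1.
  by apply: (shifted_origin hw sT (rho := rho) (La := La) e1E e2E) => //; rewrite ?e10 ?le1.
Qed.

(** All quantities are lengths multiplied by [cos w]: [La] is the lower left edge, [Bd] bounds its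
    part covered by the niche, and the remaining term bounds the upper right edge by means of the
    supporting line of angle [t1]. Crossing the lower right edge costs nothing to first order, because
    by [Ha] the niche reaches no further along it than the cap does. *)
Lemma first_order_balance : La <= 1 - (cos t1 - H) / sin (w - t1) + Bd.
Proof.
have hw' := hw; have rho0' := rho0; have La0' := La0; have t1w' := t1w; have Bd0' := Bd0.
have p0 := pi_gt0 R.
rewrite leNgt; apply/negP => hX.
pose f := fun t => cos w * b t - side_v w t (1, 1).
have [_ _ K11h] := K11.
have [t Tt|s [s0 hs [m m0 hm]]] := @exists_last_zero R Theta f fT.
  have := sT Tt; rewrite /= in_itv /= => /andP[? _]; split => //.
  by have [_] := K11h _ Tt; rewrite /f subr_ge0.
have sw : s < w.
  by case: hs => [->|[/sT]]; [lra|rewrite /= in_itv /= => /andP[]].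
have [c0 _ hCs hSs _] : [/\ 0 < cos w, cos w <= cos s <= 1, cos w <= cos (w - s) <= 1, 0 <= sin s <= 1
  & 0 <= sin (w - s) <= 1].
  by apply: trig_bounds => //; lra.
have c1 := cos_le1 w.
have hS1 : 0 < sin (w - t1) by apply: sin_gt0_pihalf; lra.
have hC1 : 0 <= cos t1 <= 1.
  by have [] := @trig_bounds R w t1 hw ltac:(lra); lra.
set Y := (cos t1 - H) / sin (w - t1) in hX *.
pose X := La - (1 - Y) - Bd; have X0 : 0 < X by rewrite /X; lra.
pose ci := (cos w)^-1; pose si := (sin (w - t1))^-1.
have ci0 : 0 < ci by rewrite invr_gt0.
have si0 : 0 < si by rewrite invr_gt0.
pose C := 2 * ci + si + 3; have C0 : 0 < C by rewrite /C; lra.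
have [e [e0 eLa erho em eX]] : exists e, [/\ 0 < e, e <= cos w * La, e <= cos w * rho, e <= m
  & e <= cos w * X / (2 * C)].
  (* The last term makes the second-order error smaller than half of the first-order gain. *)
  exists (Num.min (Num.min (cos w * La) (cos w * rho)) (Num.min m (cos w * X / (2 * C)))).
  have h1 : 0 < cos w * La by nra.
  have h2 : 0 < cos w * rho by nra.
  have h3 : 0 < cos w * X / (2 * C) by rewrite divr_gt0//; nra.
  by split; rewrite ?lt_min ?ge_min ?h1 ?h2 ?h3 ?m0 ?lexx ?orbT.
have eC : e * C <= cos w * X / 2.
  move: eX; rewrite ler_pdivlMr; last by lra.
  by rewrite ler_pdivlMr; lra.
have := translate_variation (erefl (e * cos (w - s))) (erefl (e * sin s)).
rewrite s0 sw => /(_ isT e0 eLa erho).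
have slack : forall t, Theta t -> side_v w t (1 - e * cos (w - s), 1 - e * sin s) <= cos w * b t.
  move=> t Tt.
  have -> : side_v w t (1 - e * cos (w - s), 1 - e * sin s) = side_v w t (1, 1) - e * cos w * sin (s - t).
    by rewrite /side_v /= !cosB sinB; ring.
  have [_ ht] := K11h _ Tt.
  have tw : 0 < t < w by have := sT Tt; rewrite /= in_itv.
  have [st|ts] := ltP s t.
    have := hm _ Tt st; rewrite /f => ?.
    have hs1 := sin_geN1 (s - t).
    have h1 : e * cos w <= e by rewrite ler_piMr//; lra.
    have : e * cos w * -1 <= e * cos w * sin (s - t) by rewrite ler_pM2l// mulr_gt0.
    lra.
  have : 0 <= e * cos w * sin (s - t).
    by apply: mulr_ge0; [apply: mulr_ge0; lra|apply: sin_ge0_pi; lra].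
  lra.
have tight : s = 0 \/ (Theta s /\ cos w * b s = side_v w s (1, 1)).
  by case: hs => [->|[? /eqP]]; [left|rewrite subr_eq0 => /eqP; right].
move=> /(_ slack tight).
rewrite -/ci -/si.
have -> : ((1 - e * cos (w - s)) * cos t1 - H) / sin (w - t1) = Y - e * cos (w - s) * cos t1 * si.
  by rewrite /Y /si; field; lra.
have e10 : e * cos w <= e * cos (w - s) by rewrite ler_pM2l//; lra.
have e20 : 0 <= e * sin s by apply: mulr_ge0; lra.
have e1e : e * cos (w - s) <= e by rewrite ler_piMr//; lra.
have e2e : e * sin s <= e by rewrite ler_piMr//; lra.
have e1p : 0 < e * cos (w - s) by rewrite mulr_gt0//; lra.
move: (e * cos (w - s)) (e * sin s) e10 e20 e1e e2e e1p => e1 e2 e10 e20 e1e e2e e1p main.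
exact: (first_order_absurd e0 c0 c1 ci0 si0 hC1 X0 e10 e20 e1e e2e e1p eC main).
Qed.

End Variation.

(** * Support functions *)

Section Support.
Context {R : realType}.
Implicit Types (K X : set (R * R)) (p : R * R) (t : R).

Lemma compact_coord K : compact K -> exists2 M, 0 <= M & forall p, K p -> `|p.1| <= M /\ `|p.2| <= M.
Proof.
move=> /compact_bounded [M0 [_ h]].
exists (Num.max 0 (M0 + 1)); first by rewrite le_max lexx.
move=> p Kp; have : `|p| <= M0 + 1 by apply: h => //; lra.
rewrite prod_normE ge_max => /andP[h1 h2].
by rewrite !le_max h1 h2 !orbT.
Qed.

Lemma norm_dot_u p t (M : R) : `|p.1| <= M -> `|p.2| <= M -> `|dot p (u_ t)| <= M + M.
Proof.
move=> h1 h2; rewrite /dot /=; apply: (le_trans (ler_normD _ _)); apply: lerD; rewrite normrM.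
  by apply: (le_trans (ler_piMr _ (cos_max _))).
by apply: (le_trans (ler_piMr _ (sin_max _))).
Qed.

Lemma supp_ub K p t : compact K -> K p -> dot p (u_ t) <= supp K t.
Proof.
move=> /compact_coord[M M0 hM] Kp; apply: ub_le_sup; last by exists p.
exists (M + M) => _ [q /hM[h1 h2] <-].
exact: (le_trans (ler_norm _) (norm_dot_u _ h1 h2)).
Qed.

Lemma supp_le K t x : K !=set0 -> (forall p, K p -> dot p (u_ t) <= x) -> supp K t <= x.
Proof.
move=> [p Kp] h; apply: ge_sup; first by exists (dot p (u_ t)), p.
by move=> _ [q Kq <-]; exact: h.
Qed.

Lemma dot_v p t : dot p (v_ t) = dot p (u_ (t + pi / 2)).
Proof. by rewrite /dot /= cosDpihalf sinDpihalf. Qed.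

Lemma dot_pihalf p : dot p (u_ (pi / 2)) = p.2.
Proof. by rewrite /dot /= cos_pihalf sin_pihalf; ring. Qed.

Lemma dot_Dpi p t : dot p (u_ (t + pi)) = - dot p (u_ t).
Proof. by rewrite /dot /= (cosDpi t) (sinDpi t); ring. Qed.

Lemma dot_3pihalf p : dot p (u_ (3 * pi / 2)) = - p.2.
Proof. by rewrite (_ : 3 * pi / 2 = pi / 2 + pi); [rewrite dot_Dpi dot_pihalf|field]. Qed.

Lemma halfplane_intersectionW (T T' : set R) X : T `<=` T' ->
  halfplane_intersection T X -> halfplane_intersection T' X.
Proof. by move=> TT' [A AT ->]; exists A => // a /AT /TT'. Qed.

Lemma continuous_dot (q : R * R) : continuous (fun p : R * R => dot p q).
Proof.
move=> p; rewrite /dot; apply: cvgD; apply: cvgM => //; try exact: cvg_cst.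
  exact: cvg_fst.
exact: cvg_snd.
Qed.

Lemma closed_halfplane t c : closed (halfplane t c : set (R * R)).
Proof.
have -> : halfplane t c = (fun p : R * R => dot p (u_ t)) @^-1` [set x | x <= c] by [].
by apply: preimage_closed; [move=> ? _; exact: continuous_dot|exact: closed_le].
Qed.

Lemma convex_halfplane_intersection T X : halfplane_intersection T X ->
  convex_set (X : set (convex_lmodType (R^o * R^o)%type)).
Proof.
move=> [A _ ->] x y l; rewrite !inE => hx hy a Aa.
have h1 := hx _ Aa; have h2 := hy _ Aa.
have l0 : 0 <= l%:num by []. have l1 : l%:num <= 1 by [].
rewrite /halfplane /= in h1 h2 *.
change (dot (l%:num * x.1 + (1 - l%:num) * y.1, l%:num * x.2 + (1 - l%:num) * y.2) (u_ a.1) <= a.2).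
rewrite (_ : dot _ _ = l%:num * dot x (u_ a.1) + (1 - l%:num) * dot y (u_ a.1)); last by rewrite /dot /=; ring.
set k := l%:num in l0 l1 *; move: (dot x _) (dot y _) h1 h2 => d1 d2 h1 h2.
have : k * d1 <= k * a.2 by apply: ler_wpM2l.
have : (1 - k) * d2 <= (1 - k) * a.2 by apply: ler_wpM2l => //; lra.
lra.
Qed.

End Support.

(** * Oblique coordinates of the plane *)

Section ObliqueCoordinates.
Context {R : realType}.
Notation T2 := (measurableTypeR R * measurableTypeR R)%type.
Notation mu := (@lebesgue_measure R).
Implicit Types (p q : R * R) (w s t : R) (Theta : set R) (a b : R -> R) (K : set (R * R)).

Definition oblq w p : R * R := (dot p (u_ w), p.2).
Definition swap p : R * R := (p.2, p.1).

Lemma side_u_dot w t p : side_u w t (oblq w p) = cos w * dot p (u_ t).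
Proof.
by rewrite /side_u /oblq /dot /= sinB; have := cos2Dsin2 w; rewrite !expr2 => h; ring.
Qed.

Lemma side_v_dot w t p : side_v w t (oblq w p) = cos w * dot p (u_ (t + pi / 2)).
Proof. by rewrite -dot_v /side_v /oblq /dot /= cosB; ring. Qed.

Lemma oblq_x w p : (oblq w p).1 - sin w * (oblq w p).2 = cos w * dot p (u_ 0).
Proof. by rewrite /oblq /dot /= cos0 sin0; ring. Qed.

Lemma oblq_v w p : (oblq w p).2 - sin w * (oblq w p).1 = cos w * dot p (u_ (w + pi / 2)).
Proof.
rewrite -dot_v /oblq /dot /=.
have -> : p.2 - sin w * (p.1 * cos w + p.2 * sin w) =
  p.2 * (cos w ^+ 2 + sin w ^+ 2) - sin w * (p.1 * cos w + p.2 * sin w) by rewrite cos2Dsin2 mulr1.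
by ring.
Qed.

Lemma side_u_swap w t q : side_u w (w - t) (swap q) = side_v w t q.
Proof. by rewrite /side_u /side_v /= (_ : w - (w - t) = t)//; ring. Qed.

Lemma side_v_swap w t q : side_v w (w - t) (swap q) = side_u w t q.
Proof. by rewrite /side_u /side_v /= (_ : w - (w - t) = t)//; ring. Qed.

(** The reflection in the axis of the rhombus turns the sides [u_ t] into the sides [v_ (w - t)]. *)
Lemma obl_cap_swap w Theta a b : swap @^-1` obl_cap w [set w - t | t in Theta] a b =
  obl_cap w Theta (fun t => b (w - t)) (fun t => a (w - t)).
Proof.
apply/seteqP; split => q [h1 h2 h3]; split => //.
- move=> t Tt; have [|h4 h5] := h3 (w - t); first by exists t.
  by rewrite side_u_swap in h4; rewrite side_v_swap in h5.
- by move=> _ [t Tt <-]; rewrite side_u_swap side_v_swap; have [] := h3 _ Tt.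
Qed.

Lemma obl_niche_swap w Theta a b : swap @^-1` obl_niche w [set w - t | t in Theta] a b =
  obl_niche w Theta (fun t => b (w - t)) (fun t => a (w - t)).
Proof.
apply/seteqP; split => q [h1 h2 h3]; split => //.
- case: h3 => _ [t Tt <-]; rewrite side_u_swap side_v_swap => -[h4 h5].
  by exists t.
- by case: h3 => t Tt [h4 h5]; exists (w - t); [exists t|rewrite side_u_swap side_v_swap].
Qed.

Lemma measurable_oblq w : measurable_fun setT (oblq w : T2 -> T2).
Proof.
apply: measurable_fun_pair; last exact: measurable_snd.
rewrite (_ : (fun p : T2 => dot p (u_ w)) = (fun p : T2 => cos w * p.1 + sin w * p.2 + 0 : measurableTypeR R)).
  exact: measurable_fun_affine.
by apply/funext => p; rewrite /dot /=; ring.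
Qed.

Lemma measurable_swap : measurable_fun setT (swap : T2 -> T2).
Proof. by apply: measurable_fun_pair; [exact: measurable_snd|exact: measurable_fst]. Qed.

Lemma oblq_shift w (e1 e2 : R) (X : set (R * R)) : 0 < cos w ->
  measurable (X : set T2) ->
  area (oblq w @^-1` (translate e1 e2 @^-1` X)) = area (oblq w @^-1` X).
Proof.
move=> c0 mX.
(* The translation of the plane that acts as (e1, e2) on the oblique coordinates. *)
pose c := ((e1 - sin w * e2) / cos w, e2).
rewrite -(@area_isometry _ c false (oblq w @^-1` X)).
  congr area; apply/seteqP; split => p /=;
   rewrite (_ : translate _ _ _ = oblq w (c.1 + (-1) ^+ false * p.1, c.2 + (-1) ^+ false * p.2))//;
   by rewrite /translate /oblq /dot /= expr0 !mul1r; congr pair; field; lra.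
by rewrite -[X in measurable X]setTI; exact: measurable_oblq.
Qed.

Lemma oblq_box w i j (x y u v : R) : 0 < cos w -> x <= y -> u <= v ->
  area (oblq w @^-1` box i j x y u v) = ((cos w)^-1 * ((y - x) * (v - u)))%:E.
Proof.
move=> c0 xy uv; have := @area_parallelogram _ (cos w) (sin w) x y u v i j i j c0 xy uv.
rewrite [_ / cos w]mulrC => <-; congr area; apply/seteqP.
by split => p; rewrite /box /oblq /dot /= [cos w * _]mulrC [sin w * _]mulrC.
Qed.

Lemma swap_box i j (x y u v : R) : swap @^-1` box i j x y u v = box i j u v x y.
Proof. by apply/seteqP; split => q [? ?]; split. Qed.

(** [first_order_balance] for the image of the area under the oblique coordinates. *)
Lemma area_balance w Theta a b (rho La Bd t1 H : R) :
  0 < w < pi / 2 -> finite_set Theta -> Theta `<=` `]0, w[ ->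
  obl_cap w Theta a b (1, 1) -> obl_cap w Theta a b (rho, 0) -> obl_cap w Theta a b (0, La) ->
  0 < rho -> 0 < La -> 0 <= Bd ->
  (forall t, Theta t -> cos w * (a t - 1) <= rho * cos t) ->
  (forall t, Theta t -> cos w * (b t - 1) <= Bd * cos (w - t)) ->
  0 <= t1 < w -> (forall q, obl_cap w Theta a b q -> side_u w t1 q <= H) ->
  (forall a' b', obl_cap w Theta a' b' (1, 1) -> obl_cap w Theta a' b' (0, 0) ->
    (area (oblq w @^-1` obl_cap w Theta a' b') + area (oblq w @^-1` obl_niche w Theta a b)
     <= area (oblq w @^-1` obl_cap w Theta a b) + area (oblq w @^-1` obl_niche w Theta a' b'))%E) ->
  La <= 1 - (cos t1 - H) / sin (w - t1) + Bd.
Proof.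
move=> hw fT sT K11 Krho KLa rho0 La0 Bd0 Ha Hb ht1 HH Hmax.
have c0 : 0 < cos w by apply: cos_gt0_pihalf; have := pi_gt0 R; lra.
pose nu : {measure set T2 -> \bar R} := pushforward (mu \x mu)%E (oblq w : T2 -> T2).
apply: (@first_order_balance R w Theta a b hw fT sT (nu (measurable_oblq w))
  (cos w)^-1 _ _ _ rho La Bd t1 H) => //.
- by rewrite invr_gt0.
- by move=> e1 e2 X mX; exact: oblq_shift.
- by move=> i j x y u v xy uv; exact: oblq_box.
Qed.

(** [first_order_balance] for the image of the area under the swapped oblique coordinates. Choosing
    another measure replaces reflecting the cap. *)
Lemma area_balance_swap w Theta a b (rho La Bd t1 H : R) :
  0 < w < pi / 2 -> finite_set Theta -> Theta `<=` `]0, w[ ->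
  obl_cap w Theta a b (1, 1) -> obl_cap w Theta a b (rho, 0) -> obl_cap w Theta a b (0, La) ->
  0 < rho -> 0 < La -> 0 <= Bd ->
  (forall t, Theta t -> cos w * (b t - 1) <= La * cos (w - t)) ->
  (forall t, Theta t -> cos w * (a t - 1) <= Bd * cos t) ->
  0 <= t1 < w -> (forall q, obl_cap w Theta a b q -> side_v w (w - t1) q <= H) ->
  (forall a' b', obl_cap w Theta a' b' (1, 1) -> obl_cap w Theta a' b' (0, 0) ->
    (area (oblq w @^-1` obl_cap w Theta a' b') + area (oblq w @^-1` obl_niche w Theta a b)
     <= area (oblq w @^-1` obl_cap w Theta a b) + area (oblq w @^-1` obl_niche w Theta a' b'))%E) ->
  rho <= 1 - (cos t1 - H) / sin (w - t1) + Bd.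
Proof.
move=> hw fT sT K11 Krho KLa rho0 La0 Bd0 Ha Hb ht1 HH Hmax.
have c0 : 0 < cos w by apply: cos_gt0_pihalf; have := pi_gt0 R; lra.
pose f := swap \o oblq w : T2 -> T2.
have mf : measurable_fun setT f by apply: measurableT_comp; [exact: measurable_swap|exact: measurable_oblq].
pose nu : {measure set T2 -> \bar R} := pushforward (mu \x mu)%E f.
pose Theta' := [set w - t | t in Theta].
have invol (g : R -> R) : (fun t => g (w - (w - t))) = g.
  by apply/funext => t; congr g; ring.
have capE a' b' : obl_cap w Theta' (fun t => b' (w - t)) (fun t => a' (w - t)) =
   swap @^-1` obl_cap w Theta a' b'.
  rewrite -[in RHS](invol a') -[in RHS](invol b') -(@obl_cap_swap w Theta (fun t => b' (w - t)) (fun t =>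
    a' (w - t))).
  by apply/seteqP; split => -[].
have nicheE a' b' : obl_niche w Theta' (fun t => b' (w - t)) (fun t => a' (w - t)) =
   swap @^-1` obl_niche w Theta a' b'.
  rewrite -[in RHS](invol a') -[in RHS](invol b') -(@obl_niche_swap w Theta (fun t => b' (w - t)) (fun t =>
    a' (w - t))).
  by apply/seteqP; split => -[].
apply: (@first_order_balance R w Theta' (fun t => b (w - t)) (fun t =>
  a (w - t)) hw _ _ (nu mf) (cos w)^-1 _ _ _ La rho Bd t1 H) => //.
- by apply: finite_image.
- by move=> _ [t /sT + <-]; rewrite /= !in_itv /=; lra.
- by rewrite invr_gt0.
- move=> e1 e2 X mX.
  have -> : nu mf (translate e1 e2 @^-1` X) = area (oblq w @^-1` (translate e2 e1 @^-1` (swap @^-1` X))) by [].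
  rewrite oblq_shift//.
  by rewrite -[X in measurable X]setTI; exact: measurable_swap.
- move=> i j x y u v xy uv.
  have -> : nu mf (box i j x y u v) = area (oblq w @^-1` (swap @^-1` box i j x y u v)) by [].
  by rewrite swap_box oblq_box//; congr EFin; ring.
- by rewrite capE.
- by rewrite capE.
- by rewrite capE.
- by move=> _ [t Tt <-]; rewrite (_ : w - (w - t) = t); [exact: Ha|ring].
- by move=> _ [t Tt <-]; rewrite (_ : w - (w - t) = t); [exact: Hb|ring].
- move=> q; rewrite capE => /HH; rewrite -side_u_swap (_ : w - (w - t1) = t1); [by case: q|ring].
- move=> a' b'; have Ea : a' = fun t => a' (w - (w - t)) by rewrite invol.
  have Eb : b' = fun t => b' (w - (w - t)) by rewrite invol.
  rewrite Ea Eb (capE (fun t => b' (w - t)) (fun t => a' (w - t))) (nicheE (fun t => b' (w - t)) (fun t =>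
    a' (w - t))) capE nicheE => h1 h2.
  exact: Hmax.
Qed.

End ObliqueCoordinates.

(** * Polygon caps *)

Section PolygonCaps.
Context {R : realType}.
Implicit Types (p q : R * R) (w s t : R) (Theta : set R) (a b : R -> R) (K : set (R * R)).

Definition oblq_inv w q : R * R := ((q.1 - sin w * q.2) / cos w, q.2).

Lemma oblq_invK w q : 0 < cos w -> oblq w (oblq_inv w q) = q.
Proof. by move=> c0; case: q => x y; rewrite /oblq /oblq_inv /dot /=; congr pair; field; lra. Qed.

Lemma oblq_o w : 0 < w < pi / 2 -> oblq w (o_ w) = (1, 1).
Proof.
move=> hw; rewrite /oblq /dot /=; congr pair.
set x := pi / 4 - w / 2.
have wE : w = pi / 2 - (x + x) by rewrite /x; field.
have cx : 0 < cos x by apply: cos_gt0_pihalf; have := pi_gt0 R; rewrite /x; lra.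
have -> : cos w = 2 * (sin x * cos x).
  by rewrite wE cosB cos_pihalf sin_pihalf sinD; ring.
have -> : sin w = 1 - 2 * (sin x * sin x).
  by rewrite wE sinB cos_pihalf sin_pihalf cosD; have := cos2Dsin2 x; rewrite !expr2 => h; lra.
by rewrite /tan; field; lra.
Qed.

Lemma cap_square w K p : cap w K -> K p ->
  0 <= (oblq w p).1 <= 1 /\ 0 <= (oblq w p).2 <= 1.
Proof.
move=> [[_ cK _] [h1 h2] [h3 h4] _] Kp; rewrite /oblq /=.
have := supp_ub w cK Kp; have := supp_ub (pi / 2) cK Kp.
have := supp_ub (w + pi) cK Kp; have := supp_ub (3 * pi / 2) cK Kp.
by rewrite h1 h2 h3 h4 dot_pihalf dot_3pihalf dot_Dpi; lra.
Qed.

(** The given half-planes may be replaced by the supporting ones, because each of them contains [K]. *)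
Lemma polygon_capE w Theta K : 0 < w < pi / 2 -> polygon_cap w Theta K ->
  K = oblq w @^-1` obl_cap w Theta (supp K) (fun t => supp K (t + pi / 2)).
Proof.
move=> hw pK; have [c0 _ _ _ _] := @trig_bounds R w 0 hw ltac:(lra).
have [[cb [h1 h2] [h3 h4] _] [A AT KA]] := pK; have [K0 cK _] := cb.
apply/seteqP; split => p.
  move=> Kp; have [b1 b2] := cap_square (proj1 pK) Kp.
  split => // t Tt; rewrite side_u_dot side_v_dot !ler_pM2l//.
  by split; exact: supp_ub.
move=> [b1 b2 hT]; rewrite KA => -[t c] Aa.
have le_c : supp K t <= c.
  by apply: supp_le => // q; rewrite KA => /(_ _ Aa).
rewrite /halfplane /=; apply: le_trans le_c.
rewrite /oblq /= in b1 b2.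
have hT' t' : Theta t' -> dot p (u_ t') <= supp K t' /\ dot p (u_ (t' + pi / 2)) <= supp K (t' + pi / 2).
  by move=> /hT; rewrite side_u_dot side_v_dot !ler_pM2l.
have /= := AT _ Aa; rewrite /diamond /= => -[[[|[t' + <-]]|[->|->]]|[->|->]].
- by move=> /hT' [].
- by move=> /hT' [].
- by rewrite h1; lra.
- by rewrite h2 dot_pihalf; lra.
- by rewrite h3 dot_Dpi; lra.
- by rewrite h4 dot_3pihalf; lra.
Qed.

Lemma polygon_nicheE w Theta K : 0 < w < pi / 2 ->
  polygon_niche w Theta K = oblq w @^-1` obl_niche w Theta (supp K) (fun t => supp K (t + pi / 2)).
Proof.
move=> hw; have [c0 _ _ _ _] := @trig_bounds R w 0 hw ltac:(lra).
apply/seteqP; split => p.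
  move=> [[h1 h2] [t Tt [h3 h4]]]; rewrite dot_pihalf in h2; split => //.
  by exists t => //; rewrite side_u_dot side_v_dot -dot_v !ltr_pM2l.
move=> [h1 h2 [t Tt]]; rewrite side_u_dot side_v_dot -dot_v !ltr_pM2l// => -[h3 h4].
by split; [split; rewrite ?dot_pihalf|exists t].
Qed.

Lemma obl_cap_halfplanes w Theta a b : 0 < w < pi / 2 ->
  halfplane_intersection (diamond w Theta `|` [set w + pi; 3 * pi / 2]) (oblq w @^-1` obl_cap w Theta a b).
Proof.
move=> hw; have [c0 _ _ _ _] := @trig_bounds R w 0 hw ltac:(lra).
exists ([set (w, 1); (pi / 2, 1)] `|` [set (w + pi, 0); (3 * pi / 2, 0)]
  `|` [set (t, a t) | t in Theta] `|` [set (t + pi / 2, b t) | t in Theta]).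
  move=> _ [[[[->|->]|[->|->]]|[t Tt <-]]|[t Tt <-]]; rewrite /diamond /=.
  - by left; right; left.
  - by left; right; right.
  - by right; left.
  - by right; right.
  - by left; left; left.
  - by left; left; right; exists t.
apply/seteqP; split => p.
  move=> [b1 b2 hT] _ [[[[->|->]|[->|->]]|[t Tt <-]]|[t Tt <-]]; rewrite /halfplane /=.
  - by case/andP: b1.
  - by rewrite dot_pihalf; case/andP: b2.
  - by rewrite dot_Dpi oppr_le0; case/andP: b1.
  - by rewrite dot_3pihalf oppr_le0; case/andP: b2.
  - by have [] := hT _ Tt; rewrite side_u_dot ler_pM2l.
  - by have [_] := hT _ Tt; rewrite side_v_dot ler_pM2l.
move=> hp.
have e1 : dot p (u_ w) <= 1 by apply: (hp (w, 1)); left; left; left; left.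
have e2 : dot p (u_ (pi / 2)) <= 1 by apply: (hp (pi / 2, 1)); left; left; left; right.
have e3 : dot p (u_ (w + pi)) <= 0 by apply: (hp (w + pi, 0)); left; left; right; left.
have e4 : dot p (u_ (3 * pi / 2)) <= 0 by apply: (hp (3 * pi / 2, 0)); left; left; right; right.
rewrite dot_Dpi in e3; rewrite dot_3pihalf in e4; rewrite dot_pihalf in e2.
split; rewrite /oblq /=; [lra|lra|].
move=> t Tt; rewrite side_u_dot side_v_dot !ler_pM2l//; split.
  by apply: (hp (t, a t)); left; right; exists t.
by apply: (hp (t + pi / 2, b t)); right; exists t.
Qed.

Lemma compact_obl_cap w Theta a b : 0 < w < pi / 2 -> compact (oblq w @^-1` obl_cap w Theta a b).
Proof.
move=> hw; have [c0 _ _ _ _] := @trig_bounds R w 0 hw ltac:(lra).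
have s1 : 0 <= sin w <= 1 by rewrite sin_le1 andbT; apply: sin_ge0_pi; have := pi_gt0 R; lra.
have := @subclosed_compact (R * R)%type (oblq w @^-1` obl_cap w Theta a b) (`[- (cos w)^-1,
  (cos w)^-1]%classic `*` `[0, 1]%classic); apply.
- have [A _ ->] := @obl_cap_halfplanes w Theta a b hw.
  by apply: closed_bigI => i _; exact: closed_halfplane.
- by apply: compact_setX; exact: segment_compact.
- move=> p [b1 b2 _]; rewrite /= !in_itv /= in b1 b2 *; split => //.
  rewrite /dot /= in b1.
  rewrite -[X in - X]mul1r -mulNr -[X in _ <= _ <= X]mul1r ler_pdivlMr// ler_pdivrMr//.
  have : 0 <= p.2 * sin w <= 1 by rewrite mulr_ge0 ?mulr_ile1//; lra.
  lra.
Qed.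

(** The top and bottom corners of the rhombus witness the four prescribed support numbers. *)
Lemma obl_polygon_cap w Theta a b : 0 < w < pi / 2 -> Theta `<=` `]0, w[ ->
  obl_cap w Theta a b (1, 1) -> obl_cap w Theta a b (0, 0) ->
  polygon_cap w Theta (oblq w @^-1` obl_cap w Theta a b).
Proof.
move=> hw sT K11 K00.
have [c0 _ _ _ _] := @trig_bounds R w 0 hw ltac:(lra).
have hp := @obl_cap_halfplanes w Theta a b hw.
have cK := @compact_obl_cap w Theta a b hw.
set K := oblq w @^-1` _ in hp cK *.
pose p1 := oblq_inv w (1, 1); pose p0 := oblq_inv w (0, 0).
have Kp1 : K p1 by rewrite /K /preimage /= oblq_invK.
have Kp0 : K p0 by rewrite /K /preimage /= oblq_invK.
have E1 : oblq w p1 = (1, 1) by rewrite oblq_invK.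
have E0 : oblq w p0 = (0, 0) by rewrite oblq_invK.
have Kne : K !=set0 by exists p1.
have suppE t x p : K p -> dot p (u_ t) = x -> (forall q, K q -> dot q (u_ t) <= x) -> supp K t = x.
  move=> Kp px h; apply/eqP; rewrite eq_le supp_le//= -px; exact: supp_ub.
split=> //; split.
- by split => //; exact: convex_halfplane_intersection hp.
- split; [apply: (suppE _ _ p1) => //|apply: (suppE _ _ p1) => //].
  + by case: E1.
  + by move=> q [/andP[]].
  + by rewrite dot_pihalf; case: E1.
  + by move=> q [_ /andP[]]; rewrite dot_pihalf.
- split; [apply: (suppE _ _ p0) => //|apply: (suppE _ _ p0) => //].
  + by rewrite dot_Dpi; case: E0 => ->; rewrite oppr0.
  + by move=> q [/andP[]]; rewrite dot_Dpi oppr_le0.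
  + by rewrite dot_3pihalf /= oppr0.
  + by move=> q [_ /andP[]]; rewrite dot_3pihalf oppr_le0.
- apply: halfplane_intersectionW hp => t [].
    rewrite /diamond => -[[/sT|[t' /sT + <-]]|[->|->]]; rewrite /= ?in_itv /=.
    + by move=> /andP[h1 h2]; left; left; rewrite !ltW.
    + by move=> /andP[h1 h2]; left; right; lra.
    + by left; left; rewrite lexx andbT; lra.
    + by left; right; rewrite lexx /=; lra.
  by move=> h; right.
Qed.

(** A competitor is given by numbers that may exceed its support numbers. This is harmless: it only
    makes [obl_niche] larger than its actual niche. *)
Lemma maximum_polygon_cap_obl w Theta K a b : 0 < w < pi / 2 -> maximum_polygon_cap w Theta K ->
  obl_cap w Theta a b (1, 1) -> obl_cap w Theta a b (0, 0) ->
  (area (oblq w @^-1` obl_cap w Theta a b) + area (polygon_niche w Theta K)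
     <= area K + area (oblq w @^-1` obl_niche w Theta a b))%E.
Proof.
move=> hw [[_ fT sT] pK _ Kmax] K11 K00.
have [c0 _ _ _ _] := @trig_bounds R w 0 hw ltac:(lra).
have pK' := obl_polygon_cap hw sT K11 K00.
set K' := oblq w @^-1` _ in pK' *.
have hmax := Kmax _ pK'.
have niche_le : (area (polygon_niche w Theta K') <= area (oblq w @^-1` obl_niche w Theta a b))%E.
  rewrite polygon_nicheE//; apply: area_mono => p [h1 h2 [t Tt [h3 h4]]]; split => //.
  have Kne : K' !=set0 by exists (oblq_inv w (1, 1)); rewrite /K' /preimage /= oblq_invK.
  have ha : supp K' t <= a t.
    by apply: supp_le => // q [_ _ /(_ _ Tt)[]]; rewrite side_u_dot ler_pM2l.
  have hb : supp K' (t + pi / 2) <= b t.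
    by apply: supp_le => // q [_ _ /(_ _ Tt)[_]]; rewrite side_v_dot ler_pM2l.
  exists t => //; split; [apply: (lt_le_trans h3)|apply: (lt_le_trans h4)]; rewrite ler_pM2l//; lra.
have fin X : polygon_cap w Theta X -> area X \is a fin_num.
  move=> pX; rewrite ge0_fin_numE ?measure_ge0//.
  apply: (@le_lt_trans _ _ (area (oblq w @^-1` box true false 0 1 0 1))); last by rewrite oblq_box ?ltry.
  apply: area_mono => p Xp; have [h1 h2] := cap_square (proj1 pX) Xp.
  by rewrite /preimage /box /= !in_itv.
have key (k k' : R) (n n' m : \bar R) : (0 <= n -> 0 <= n' -> k'%:E - n' <= k%:E - n ->
    n' <= m -> k'%:E + n <= k%:E + m)%E.
  case: n => [x| |] //; case: n' => [y| |] //; case: m => [z| |] //=; rewrite ?addey ?leey//.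
  by move=> _ _; rewrite -!EFinB -!EFinD !lee_fin; lra.
have nK := fin _ pK; have nK' := fin _ pK'.
move: hmax niche_le; rewrite /polygon_area -(fineK nK) -(fineK nK') => h1 h2.
by apply: key h1 h2; exact: measure_ge0.
Qed.

End PolygonCaps.

(** * Balance in terms of the support function *)

Section Balance.
Context {R : realType}.
Variables (w : R) (Theta : set R) (K : set (R * R)).
Hypotheses (hw : 0 < w < pi / 2) (Kmax : maximum_polygon_cap w Theta K).
Let c := cos w.
Let s := sin w.
Let a := supp K.
Let b := fun t => supp K (t + pi / 2).
Let r := supp K 0.
Let l := supp K (w + pi / 2).

Let c0 : 0 < c.
Proof. by have [] := @trig_bounds R w 0 hw ltac:(have := hw; lra). Qed.
Let s0 : 0 < s <= 1.
Proof. by rewrite sin_le1 andbT; apply: sin_gt0_pihalf. Qed.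
Let sc : s ^+ 2 + c ^+ 2 = 1.
Proof. by rewrite addrC cos2Dsin2. Qed.
Let sT : Theta `<=` `]0, w[.
Proof. by have [[]] := Kmax. Qed.
Let pK : polygon_cap w Theta K.
Proof. by have [] := Kmax. Qed.
Let cK : compact K.
Proof. by have [[[]]] := pK. Qed.
Let KE : K = oblq w @^-1` obl_cap w Theta a b.
Proof. exact: polygon_capE. Qed.
Let Ko : K (o_ w).
Proof. by have [] := Kmax. Qed.
Let Kne : K !=set0.
Proof. by exists (o_ w). Qed.

Lemma cap11 : obl_cap w Theta a b (1, 1).
Proof. by move: Ko; rewrite KE /= oblq_o. Qed.

Let cap_x p : (oblq w p).1 - s * (oblq w p).2 = c * dot p (u_ 0).
Proof. exact: oblq_x. Qed.

Let cap_v p : (oblq w p).2 - s * (oblq w p).1 = c * dot p (u_ (w + pi / 2)).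
Proof. exact: oblq_v. Qed.

Lemma trig_Theta t : Theta t -> [/\ c <= cos t <= 1, c <= cos (w - t) <= 1, 0 <= sin t <= 1
  & 0 <= sin (w - t) <= 1].
Proof. exact: trig_in. Qed.

(** [c * r] and [c * l] are the oblique coordinates of the two acute tips of [K] on the lower edges of
    the rhombus. They are at least [1 - s] because [o_ w] belongs to [K]. *)
Lemma tip_bounds : [/\ 1 - s <= c * r <= 1, 1 - s <= c * l <= 1,
  (forall t, Theta t -> c * r * cos t <= c * a t) &
  (forall t, Theta t -> c * l * cos (w - t) <= c * b t)].
Proof.
have c0' := c0; have s0' := s0.
have oE := oblq_o hw.
have hr : c * r <= 1.
  rewrite mulrC -ler_pdivlMr//; apply: supp_le => // p Kp; rewrite ler_pdivlMr// mulrC -cap_x.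
  have [h1 h2] := cap_square (proj1 pK) Kp.
  have : 0 <= s * (oblq w p).2 by apply: mulr_ge0; lra.
  lra.
have hl : c * l <= 1.
  rewrite mulrC -ler_pdivlMr//; apply: supp_le => // p Kp; rewrite ler_pdivlMr// mulrC -cap_v.
  have [h1 h2] := cap_square (proj1 pK) Kp.
  have : 0 <= s * (oblq w p).1 by apply: mulr_ge0; lra.
  lra.
have hr' : 1 - s <= c * r.
  apply: (@le_trans _ _ (c * dot (o_ w) (u_ 0))); last by rewrite ler_pM2l//; exact: supp_ub.
  by rewrite -cap_x oE /=; lra.
have hl' : 1 - s <= c * l.
  apply: (@le_trans _ _ (c * dot (o_ w) (u_ (w + pi / 2)))); last by rewrite ler_pM2l//; exact: supp_ub.
  by rewrite -cap_v oE /=; lra.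
split; rewrite ?hr ?hr' ?hl ?hl'// => t Tt; have [hCt hCe hSt hSe] := trig_Theta Tt.
  rewrite -mulrA ler_pM2l// -ler_pdivlMr; last by lra.
  apply: supp_le => // p Kp; rewrite ler_pdivlMr; last by lra.
  apply: (le_trans _ (supp_ub t cK Kp)); rewrite /dot /= cos0 sin0.
  have [_ h2] := cap_square (proj1 pK) Kp; rewrite /oblq /= in h2.
  have : 0 <= p.2 * sin t by apply: mulr_ge0; lra.
  lra.
rewrite -mulrA ler_pM2l// -ler_pdivlMr; last by lra.
apply: supp_le => // p Kp; rewrite ler_pdivlMr; last by lra.
apply: (le_trans _ (supp_ub (t + pi / 2) cK Kp)); rewrite -!dot_v.
have [h2 _] := cap_square (proj1 pK) Kp; rewrite /oblq /= in h2.
have -> : dot p (v_ t) = dot p (v_ w) * cos (w - t) + dot p (u_ w) * sin (w - t).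
  rewrite {1}(_ : t = w - (w - t)); last by ring.
  by rewrite /dot /= (cosB w (w - t)) (sinB w (w - t)); ring.
have : 0 <= dot p (u_ w) * sin (w - t) by apply: mulr_ge0; lra.
lra.
Qed.

(** The corner [o_ w] is on the positive side of every normal, as [t < w < pi / 2]. *)
Lemma support_ge0 t : Theta t -> 0 <= c * a t /\ 0 <= c * b t.
Proof.
move=> Tt; have := sT Tt; rewrite /= in_itv /= => ht; have hw' := hw; have p0 := pi_gt0 R.
have [_ _ /(_ _ Tt)[]] := cap11; rewrite /side_u /side_v /= !mul1r => h1 h2.
have e1 : sin t <= cos (w - t).
  have -> : sin t = cos (pi / 2 - t) by rewrite cosB cos_pihalf sin_pihalf; ring.
  by apply/ltW; rewrite ltr_cos ?in_itv /=; lra.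
have e2 : sin (w - t) <= cos t.
  have -> : sin (w - t) = cos (pi / 2 - (w - t)) by rewrite cosB cos_pihalf sin_pihalf; ring.
  by apply/ltW; rewrite ltr_cos ?in_itv /=; lra.
by rewrite /c; split; lra.
Qed.

Lemma cap_tip_r : obl_cap w Theta a b (c * r, 0).
Proof.
have [h1 h2 h3 h4] := tip_bounds; have s0' := s0.
split => /=; [lra|lra|] => t Tt; have [hCt hCe hSt hSe] := trig_Theta Tt.
have [g1 g2] := support_ge0 Tt.
rewrite /side_u /side_v /= !mul0r subr0 sub0r; split; first exact: h3.
have : 0 <= c * r * sin t by apply: mulr_ge0; lra.
by rewrite -/c; lra.
Qed.

Lemma cap_tip_l : obl_cap w Theta a b (0, c * l).
Proof.
have [h1 h2 h3 h4] := tip_bounds; have s0' := s0.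
split => /=; [lra|lra|] => t Tt; have [hCt hCe hSt hSe] := trig_Theta Tt.
have [g1 g2] := support_ge0 Tt.
rewrite /side_u /side_v /= !mul0r subr0 sub0r; split; last exact: h4.
have : 0 <= c * l * sin (w - t) by apply: mulr_ge0; lra.
by rewrite -/c; lra.
Qed.

(** [K] lies in the rhombus cut off at its two tips, so its support numbers are at most those of this
    hexagon. *)
Lemma support_u_le t x : (forall q, [/\ 0 <= q.1 <= 1, 0 <= q.2 <= 1, q.1 - s * q.2 <= c * r
  & q.2 - s * q.1 <= c * l] ->
  side_u w t q <= x) -> c * a t <= x.
Proof.
move=> h; rewrite mulrC -ler_pdivlMr//; apply: supp_le => // p Kp.
rewrite ler_pdivlMr// mulrC -side_u_dot; apply: h.
have [h1 h2] := cap_square (proj1 pK) Kp; split => //.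
  by rewrite cap_x ler_pM2l//; exact: supp_ub.
by rewrite cap_v ler_pM2l//; exact: supp_ub.
Qed.

Lemma support_v_le t x : (forall q, [/\ 0 <= q.1 <= 1, 0 <= q.2 <= 1, q.1 - s * q.2 <= c * r
  & q.2 - s * q.1 <= c * l] ->
  side_v w t q <= x) -> c * b t <= x.
Proof.
move=> h; rewrite mulrC -ler_pdivlMr//; apply: supp_le => // p Kp.
rewrite ler_pdivlMr// mulrC -side_v_dot; apply: h.
have [h1 h2] := cap_square (proj1 pK) Kp; split => //.
  by rewrite cap_x ler_pM2l//; exact: supp_ub.
by rewrite cap_v ler_pM2l//; exact: supp_ub.
Qed.

Let Hmax a' b' : obl_cap w Theta a' b' (1, 1) -> obl_cap w Theta a' b' (0, 0) ->
    (area (oblq w @^-1` obl_cap w Theta a' b') + area (oblq w @^-1` obl_niche w Theta a b)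
     <= area (oblq w @^-1` obl_cap w Theta a b) + area (oblq w @^-1` obl_niche w Theta a' b'))%E.
Proof.
by move=> h1 h2; rewrite -KE -polygon_nicheE//; exact: maximum_polygon_cap_obl.
Qed.

Let fT : finite_set Theta.
Proof. by have [[]] := Kmax. Qed.

Lemma sin_diff t : sin (w - t) = s * cos t - c * sin t.
Proof. by rewrite sinB. Qed.

Lemma sin_codiff t : sin t = s * cos (w - t) - c * sin (w - t).
Proof. by rewrite {1}(_ : t = w - (w - t)) ?sinB//; ring. Qed.

(** The niche does not pass the right tip: the top of the rhombus has height one. *)
Lemma support_u_le_tip t : Theta t -> c * (a t - 1) <= c * r * cos t.
Proof.
move=> Tt; have [hCt hCe hSt hSe] := trig_Theta Tt; have c0' := c0.
rewrite mulrBr mulr1 lerBlDr; apply: support_u_le => q [h1 h2 h3 h4].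
rewrite /side_u sin_diff.
have : (q.1 - s * q.2) * cos t <= c * r * cos t by rewrite ler_pM2r//; lra.
have : c * (q.2 * sin t) <= c * 1.
  by rewrite ler_pM2l// mulr_ile1//; lra.
lra.
Qed.

Lemma support_v_le_tip t : Theta t -> c * (b t - 1) <= c * l * cos (w - t).
Proof.
move=> Tt; have [hCt hCe hSt hSe] := trig_Theta Tt; have c0' := c0.
rewrite mulrBr mulr1 lerBlDr; apply: support_v_le => q [h1 h2 h3 h4].
rewrite /side_v sin_codiff.
have : (q.2 - s * q.1) * cos (w - t) <= c * l * cos (w - t) by rewrite ler_pM2r//; lra.
have : c * (q.1 * sin (w - t)) <= c * 1.
  by rewrite ler_pM2l// mulr_ile1//; lra.
lra.
Qed.

(** The vertex of the hexagon that is extremal for [u_ t] lies on the upper right side and on the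
    line that cuts off the right tip. The combination [e1] of these two constraints bounds [side_u]. *)
Lemma support_u_le_corner t tau : Theta t -> (1 - c * r) / s * sin t + tau * cos t <= 1 ->
  c * (a t - 1) <= c * (r - tau) * cos t.
Proof.
move=> Tt ht; have [hCt hCe hSt hSe] := trig_Theta Tt; have c0' := c0; have s0' := s0.
rewrite mulrBr mulr1 lerBlDr; apply: support_u_le => q [h1 h2 h3 h4].
rewrite /side_u.
have e1 : s * (q.1 * cos t - q.2 * sin (w - t)) = sin (w - t) * (q.1 - s * q.2) + c * sin t * q.1.
  by rewrite sin_diff; ring.
have e2 : sin (w - t) * (q.1 - s * q.2) <= sin (w - t) * (c * r) by apply: ler_wpM2l; lra.
have e3 : c * sin t * q.1 <= c * sin t.
  by rewrite ler_piMr ?mulr_ge0//; lra.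
have e4 : c * ((1 - c * r) / s * sin t + tau * cos t) <= c * 1 by rewrite ler_pM2l.
have e5 : s * (c * ((1 - c * r) / s * sin t + tau * cos t)) <= s * (c * 1) by rewrite ler_pM2l//; lra.
have e6 : s * (c * ((1 - c * r) / s * sin t + tau * cos t)) = c * (1 - c * r) * sin t + s * c * tau * cos t.
  by field; lra.
rewrite e6 in e5.
have : s * (q.1 * cos t - q.2 * sin (w - t)) <= s * (c * (r - tau) * cos t + c).
  rewrite e1; have := sin_diff t => e7; rewrite e7 in e2 *; lra.
by rewrite ler_pM2l//; lra.
Qed.

(** The reflection of [support_u_le_corner]: the extremal vertex lies on the top side and on the line
    that cuts off the left tip. If the hypothesis holds for all [t], the niche leaves a length [tau] of
    the lower left edge uncovered. *)
Lemma support_v_le_corner t tau : Theta t -> (1 - c * l) / s * sin (w - t) + tau * cos (w - t) <= 1 ->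
  c * (b t - 1) <= c * (l - tau) * cos (w - t).
Proof.
move=> Tt ht; have [hCt hCe hSt hSe] := trig_Theta Tt; have c0' := c0; have s0' := s0.
rewrite mulrBr mulr1 lerBlDr; apply: support_v_le => q [h1 h2 h3 h4].
rewrite /side_v.
have e1 : s * (q.2 * cos (w - t) - q.1 * sin t) = sin t * (q.2 - s * q.1) + c * sin (w - t) * q.2.
  by rewrite sin_codiff; ring.
have e2 : sin t * (q.2 - s * q.1) <= sin t * (c * l) by apply: ler_wpM2l; lra.
have e3 : c * sin (w - t) * q.2 <= c * sin (w - t).
  by rewrite ler_piMr ?mulr_ge0//; lra.
have e4 : c * ((1 - c * l) / s * sin (w - t) + tau * cos (w - t)) <= c * 1 by rewrite ler_pM2l.
have e5 : s * (c * ((1 - c * l) / s * sin (w - t) + tau * cos (w - t))) <= s *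
  (c * 1) by rewrite ler_pM2l//; lra.
have e6 : s * (c * ((1 - c * l) / s * sin (w - t) + tau * cos (w - t))) =
  c * (1 - c * l) * sin (w - t) + s * c * tau * cos (w - t).
  by field; lra.
rewrite e6 in e5.
have : s * (q.2 * cos (w - t) - q.1 * sin t) <= s * (c * (l - tau) * cos (w - t) + c).
  rewrite e1; have := sin_codiff t => e7; rewrite e7 in e2 *; lra.
by rewrite ler_pM2l//; lra.
Qed.

(** The niche leaves at least [tau] of the lower left edge uncovered, so the upper right edge is at
    least that long, while the right-hand side bounds it from above. *)
Lemma balance_left t1 tau : 0 <= t1 < w -> tau <= l ->
  (forall eta, 0 <= eta <= w -> (1 - c * l) / s * sin eta + tau * cos eta <= 1) ->
  c * tau <= 1 - (cos t1 - c * supp K t1) / sin (w - t1).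
Proof.
move=> ht1 taul htau; have [h1 h2 _ _] := tip_bounds; have c0' := c0; have s0' := s0.
have s1 : s < 1.
  rewrite lt_def; have := sc; have : 0 < c ^+ 2 by rewrite exprn_gt0.
  case: (eqVneq 1 s) => [<-|]; [by rewrite expr1n; lra|lra].
suff : c * l <= 1 - (cos t1 - c * supp K t1) / sin (w - t1) + c * (l - tau) by lra.
apply: (area_balance hw fT sT cap11 cap_tip_r cap_tip_l) => //.
- by lra.
- by lra.
- by apply: mulr_ge0; lra.
- exact: support_u_le_tip.
- move=> t Tt; apply: support_v_le_corner => //; apply: htau.
  by have := sT Tt; rewrite /= in_itv /=; lra.
- move=> q hq; rewrite -(oblq_invK q c0) side_u_dot ler_pM2l//; apply: supp_ub => //.
  by rewrite KE /= oblq_invK.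
Qed.

Lemma balance_right t1 tau : 0 <= t1 < w -> tau <= r ->
  (forall eta, 0 <= eta <= w -> (1 - c * r) / s * sin eta + tau * cos eta <= 1) ->
  c * tau <= 1 - (cos t1 - c * supp K (w - t1 + pi / 2)) / sin (w - t1).
Proof.
move=> ht1 taul htau; have [h1 h2 _ _] := tip_bounds; have c0' := c0; have s0' := s0.
have s1 : s < 1.
  rewrite lt_def; have := sc; have : 0 < c ^+ 2 by rewrite exprn_gt0.
  case: (eqVneq 1 s) => [<-|]; [by rewrite expr1n; lra|lra].
suff : c * r <= 1 - (cos t1 - c * supp K (w - t1 + pi / 2)) / sin (w - t1) + c * (r - tau) by lra.
apply: (area_balance_swap hw fT sT cap11 cap_tip_r cap_tip_l) => //.
- by lra.
- by lra.
- by apply: mulr_ge0; lra.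
- exact: support_v_le_tip.
- move=> t Tt; apply: support_u_le_corner => //; apply: htau.
  by have := sT Tt; rewrite /= in_itv /=; lra.
- move=> q hq; rewrite -(oblq_invK q c0) side_v_dot ler_pM2l//; apply: supp_ub => //.
  by rewrite KE /= oblq_invK.
Qed.

End Balance.

(** * A point that blocks the inner corner *)

Section Blocking.
Context {R : realType}.

(** The hypothesis says that the point at [(1 - x, D)] from [o_ w], in an orthonormal frame, is more
    than one away from it in the direction with cosine [C] and sine [S]. *)
Lemma wide_gt0 (x D C S : R) : 0 <= x -> 0 <= C <= 1 -> 0 <= S ->
  1 < (1 - x) * C + D * S -> 0 < D.
Proof.
move=> x0 hC S0 h; rewrite ltNge; apply/negP => D0.
have : D * S <= 0 by rewrite mulr_le0_ge0.
have : 0 <= x * C by apply: mulr_ge0; lra.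
lra.
Qed.

(** Cauchy-Schwarz: a projection longer than one forces a vector longer than one. *)
Lemma wide_norm (x D C S : R) : C ^+ 2 + S ^+ 2 = 1 -> 0 <= C -> S <= 1 -> 0 < D < 1 ->
  1 < (1 - x) * C + D * S -> 0 < 1 - x /\ 1 < (1 - x) ^+ 2 + D ^+ 2.
Proof.
move=> CS C0 S1 hD h; split.
  rewrite ltNge; apply/negP => x1.
  have : (1 - x) * C <= 0 by rewrite mulr_le0_ge0.
  have : D * S <= D by rewrite ler_piMr//; lra.
  lra.
have e1 : ((1 - x) ^+ 2 + D ^+ 2) * (C ^+ 2 + S ^+ 2) =
  ((1 - x) * C + D * S) ^+ 2 + ((1 - x) * S - D * C) ^+ 2 by ring.
rewrite CS mulr1 in e1; rewrite e1.
have : 1 < ((1 - x) * C + D * S) ^+ 2 by rewrite expr_gt1//; lra.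
have := sqr_ge0 ((1 - x) * S - D * C); lra.
Qed.

Lemma ge_15_17 (x y : R) : 0 <= x -> y ^+ 2 + x ^+ 2 = 1 -> 0 <= y <= 8 / 17 -> 15 / 17 <= x.
Proof.
move=> x0 xy hy; have h : y * y <= 8 / 17 * (8 / 17) by apply: ler_pM; lra.
rewrite leNgt; apply/negP => x15; have : x * x < 15 / 17 * (15 / 17) by apply: ltr_pM.
lra.
Qed.

(** [C] and [D] are the cosine and sine of the angle by which [t] falls short of [w], and [hu], [hv]
    the two support numbers at [t]. Since [l] is large, the second alternative fails, and the first
    one bounds [hu]. *)
Lemma blocked_support_algebra (c s D C al zv l hu hv : R) :
  0 < c <= 8 / 17 -> 15 / 17 <= s <= 1 -> c * (zv + D) = 1 - s -> 0 < D < c -> 15 / 17 <= C <= 1 ->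
  D ^+ 2 + C ^+ 2 = 1 -> C < 1 - al -> l * C <= hv -> c + 2 * (1 - s) < c * l ->
  hu - 1 <= al * C - zv * D \/ hv - 1 <= zv * C + al * D ->
  1 - (c * C + s * D - c * hu) / D < 2 * c ^+ 2.
Proof.
move=> hc hs zvE hD hC CD alC hl ll hAB; have [c0 D0] : 0 < c /\ 0 < D by lra.
pose T := zv + D; have cT : c * T = 1 - s by [].
have T0 : 0 <= T by rewrite -(pmulr_rge0 _ c0) cT; lra.
have zvT : zv = T - D by rewrite /T; ring.
move: T zvT cT T0 {zvE} => T zvT cT T0.
have noB : zv * C + al * D < hv - 1.
  apply: (@lt_le_trans _ _ (l * C - 1)); last by rewrite lerD2r.
  have l1 : 1 + 2 * T < l by rewrite -(ltr_pM2l c0); lra.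
  have : (1 + 2 * T) * C <= l * C by rewrite ler_wpM2r//; lra.
  have : al * D <= (1 - C) * D by rewrite ler_wpM2r//; lra.
  have : 0 <= T * C by rewrite mulr_ge0//; lra.
  have : 0 < (C - 1) + D * (2 * C - 1) by clear -hC hD CD hc; nra.
  rewrite zvT; lra.
have hA : hu <= 1 + al * C - (T - D) * D by rewrite -zvT; lra.
rewrite ltrBlDr -ltrBlDl ltr_pdivlMr//.
have e1 : c * hu <= c * (1 + al * C - (T - D) * D) by rewrite ler_pM2l.
have e2 : c * (1 + al * C - (T - D) * D) = c + c * al * C - (1 - s) * D + c * D ^+ 2 by rewrite -cT; ring.
have e3 : c * (C * C) < c * (C * (1 - al)) by rewrite !ltr_pM2l//; lra.
have e4 : 0 <= c * D * (c - D) by rewrite !mulr_ge0//; lra.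
have e5 : C * C = 1 - D ^+ 2 by rewrite -CD; ring.
rewrite e5 in e3.
lra.
Qed.

(** [al] and [zv] are the products of the blocking point with [u_ w] and [v_ w], and [h] is a support
    function or its reflection. The angle [eta] has sine [D], the distance from the point to [o_ w] along
    the lower left edge. This choice makes the bound on the upper right edge equal to [2 * D], and
    [D] is less than [cos w]. *)
Lemma blocked_support (w l al zv phi : R) (h : R -> R) :
  0 < w < pi / 2 -> cos w <= 8 / 17 ->
  (forall eta, 0 <= eta <= w -> h (w - eta) - 1 <= al * cos eta - zv * sin eta \/
     h (w - eta + pi / 2) - 1 <= zv * cos eta + al * sin eta) ->
  (forall eta, 0 <= eta <= w -> l * cos eta <= h (w - eta + pi / 2)) ->
  cos w + 2 * (1 - sin w) < cos w * l -> 0 <= al ->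
  (1 - sin w) / cos w - zv < cos w ->
  0 <= phi < pi / 2 ->
  1 < (1 - al) * cos phi + ((1 - sin w) / cos w - zv) * sin phi ->
  exists2 eta, 0 < eta <= w & 1 - (cos (w - eta) - cos w * h (w - eta)) / sin eta < 2 * cos w ^+ 2.
Proof.
move=> hw c817 hAB hl ll al0; have p0 := pi_gt0 R.
have c0 : 0 < cos w by apply: cos_gt0_pihalf; lra.
have s0 : 0 < sin w by apply: sin_gt0_pihalf.
have s15 : 15 / 17 <= sin w <= 1.
  by rewrite sin_le1 (@ge_15_17 _ (cos w)) ?cos2Dsin2//; lra.
set D := (1 - sin w) / cos w - zv => Dc hphi wide.
have zvE : cos w * (zv + D) = 1 - sin w.
  by rewrite (_ : zv + D = (1 - sin w) / cos w); [rewrite mulrC divfK//; lra|rewrite /D; ring].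
move: D Dc zvE wide => D Dc zvE wide.
have cp : 0 <= cos phi <= 1 by rewrite cos_le1 andbT; apply: cos_ge0_pihalf; lra.
have sp : 0 <= sin phi by apply: sin_ge0_pi; lra.
have D0 : 0 < D by apply: wide_gt0 wide.
have [al1 norm1] : 0 < 1 - al /\ 1 < (1 - al) ^+ 2 + D ^+ 2.
  by apply: wide_norm wide; rewrite ?cos2Dsin2 ?sin_le1//; lra.
(* For t = w - eta, the line with normal u_ t at distance one beyond the blocking point passes close to o_ w. *)
pose eta := asin D.
have Dr : -1 <= D <= 1 by lra.
have se : sin eta = D by rewrite asinK ?in_itv.
have ce : 0 <= cos eta by rewrite cos_asin// sqrtr_ge0.
have CD : D ^+ 2 + cos eta ^+ 2 = 1 by rewrite -se addrC cos2Dsin2.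
have er : - (pi / 2) <= eta <= pi / 2 by rewrite asin_geNpi2 ?asin_lepi2.
have e0 : 0 < eta.
  have h1 : sin 0 < sin eta by rewrite sin0 se.
  by move: h1; rewrite ltr_sin ?in_itv //=; lra.
have ew : eta < w.
  have h2 : sin eta < sin w by rewrite se; lra.
  by move: h2; rewrite ltr_sin ?in_itv //=; lra.
have C15 : 15 / 17 <= cos eta <= 1 by rewrite cos_le1 andbT; apply: ge_15_17 CD _; lra.
have alC : cos eta < 1 - al by rewrite -(@ltr_pXn2r _ 2) ?nnegrE//; lra.
have hew : 0 <= eta <= w by rewrite !ltW.
exists eta; first by rewrite e0 ltW.
have := hAB eta hew; rewrite se cosB se => hAB'.
apply: (blocked_support_algebra _ s15 zvE _ C15 CD alC (hl _ hew) ll hAB'); first by rewrite c0.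
by rewrite D0.
Qed.

End Blocking.

(** * Area of a truncated rhombus *)

Section AreaBound.
Context {R : realType}.
Notation T2 := (measurableTypeR R * measurableTypeR R)%type.
Notation mu := (@lebesgue_measure R).

(** The half of a box on one side of a line through its centre. *)
Definition half_box (x y u v A B : R) : set (R * R) :=
  box true false x y u v `&` [set q | A * q.1 + B * q.2 <= A * ((x + y) / 2) + B * ((u + v) / 2)].

Lemma measurable_oblq_preimage w (X : set T2) : measurable X -> measurable (oblq w @^-1` X : set T2).
Proof. by move=> mX; rewrite -[X in measurable X]setTI; exact: measurable_oblq. Qed.

Lemma measurable_half_box x y u v A B : measurable (half_box x y u v A B : set T2).
Proof.
apply: measurableI; first exact: measurable_box.
by apply: (proj1 (@measurable_side R (fun q => A * q.1 + B * q.2) A B 0 _ _)) => q; ring.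
Qed.

(** The reflection in the centre carries the half box onto the other half and preserves the area. *)
Lemma area_half_box (w x y u v A B : R) : 0 < cos w -> x <= y -> u <= v ->
  (((cos w)^-1 * ((y - x) * (v - u)) / 2)%:E <= area (oblq w @^-1` half_box x y u v A B))%E.
Proof.
move=> c0 xy uv; set X := oblq w @^-1` half_box x y u v A B.
have mX : measurable (X : set T2) by apply: measurable_oblq_preimage; exact: measurable_half_box.
(* Twice the centre of the box. *)
pose p0 := oblq_inv w (x + y, u + v).
pose X' := (fun p : R * R => (p0.1 + (-1) ^+ true * p.1, p0.2 + (-1) ^+ true * p.2)) @^-1` X.
have eX' : area X' = area X by exact: area_isometry.
have mX' : measurable (X' : set T2).
  have mf : measurable_fun setT (fun p : T2 => (p0.1 + (-1) ^+ true * p.1, p0.2 + (-1) ^+ true * p.2) : T2).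
    apply: measurable_fun_pair.
      by apply: measurable_funD => //; apply: measurable_funM.
    by apply: measurable_funD => //; apply: measurable_funM.
  by rewrite -[X in measurable X]setTI; exact: mf.
have h : (area (oblq w @^-1` box true false x y u v) <= area X + area X')%E.
  apply: (@le_trans _ _ (area (X `|` X'))); last exact: measureU2.
  apply: area_mono => p; rewrite /preimage /= => hp.
  have [g|g] := leP (A * (oblq w p).1 + B * (oblq w p).2) (A * ((x + y) / 2) + B * ((u + v) / 2)).
    by left; split.
  right; rewrite /X' /X /preimage /=.
  have -> : oblq w (p0.1 + (-1) ^+ true * p.1, p0.2 + (-1) ^+ true * p.2) =
      (x + y - (oblq w p).1, u + v - (oblq w p).2).
    by rewrite /oblq /dot /= expr1; congr pair; [field; lra|ring].
  move: hp g; move: (oblq w p) => q; rewrite /half_box /box /= !in_itv /= => hp g.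
  by split; [lra|lra].
move: h; rewrite oblq_box// eX'.
have X0 : (0 <= area X)%E by exact: measure_ge0.
case: (area X) X0 => [z| |] // _; rewrite ?leey//.
by rewrite -EFinD !lee_fin; lra.
Qed.

(** Two disjoint triangles with legs [k] and [k / sin w] are missing from the unit square. The strict
    inequalities keep [X] off the lines that bound these triangles. *)
Lemma area_truncated_le (w k : R) (X : set (R * R)) : 0 < cos w -> 0 < sin w -> 0 <= k -> k < sin w ->
  (forall p, X p -> [/\ 0 <= (oblq w p).1 <= 1, 0 <= (oblq w p).2 <= 1,
     k < 1 - ((oblq w p).1 - sin w * (oblq w p).2) & k < 1 - ((oblq w p).2 - sin w * (oblq w p).1)]) ->
  (area X <= ((cos w)^-1 * (1 - k ^+ 2 / sin w))%:E)%E.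
Proof.
move=> c0 s0 k0 ks hX; have s1 := sin_le1 w.
have ks1 : k / sin w <= 1 by rewrite ler_pdivrMr// mul1r ltW.
have ks0 : 0 <= k / sin w by rewrite divr_ge0// ltW.
have ksk : sin w * (k / sin w) = k by rewrite mulrC divfK//; lra.
set d := k / sin w in ks1 ks0 ksk.
pose E1 := oblq w @^-1` half_box (1 - k) 1 0 d (-1) (sin w).
pose E2 := oblq w @^-1` half_box 0 d (1 - k) 1 (sin w) (-1).
have mE1 : measurable (E1 : set T2) by apply: measurable_oblq_preimage; exact: measurable_half_box.
have mE2 : measurable (E2 : set T2) by apply: measurable_oblq_preimage; exact: measurable_half_box.
pose P := oblq w @^-1` box true false 0 1 0 1.
have mP : measurable (P : set T2) by apply: measurable_oblq_preimage; exact: measurable_box.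
have aP : area P = ((cos w)^-1)%:E by rewrite /P oblq_box//; congr EFin; ring.
have a1 := @area_half_box w (1 - k) 1 0 d (-1) (sin w) c0 ltac:(clear -k0; lra) ks0.
have a2 := @area_half_box w 0 d (1 - k) 1 (sin w) (-1) c0 ks0 ltac:(clear -k0; lra).
have E12 : E1 `&` E2 = set0.
  rewrite -subset0 => p.
  change (half_box (1 - k) 1 0 d (-1) (sin w) (oblq w p) /\ half_box 0 d (1 - k) 1 (sin w) (-1)
    (oblq w p) -> False).
  move: (oblq w p) => q; rewrite /half_box /box /= !in_itv /= => -[[[g1 g2] h2] [[g3 g4] h4]].
  have : (1 - sin w) * (q.1 + q.2) <= (1 - sin w) * 2 by apply: ler_wpM2l; lra.
  lra.
have XP : X `<=` P `\` (E1 `|` E2).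
  move=> p /hX.
  change ([/\ 0 <= (oblq w p).1 <= 1, 0 <= (oblq w p).2 <= 1,
     k < 1 - ((oblq w p).1 - sin w * (oblq w p).2) & k < 1 - ((oblq w p).2 - sin w * (oblq w p).1)] ->
     box true false 0 1 0 1 (oblq w p) /\ ~ (half_box (1 - k) 1 0 d (-1) (sin w) (oblq w p) \/
       half_box 0 d (1 - k) 1 (sin w) (-1) (oblq w p))).
  move: (oblq w p) => q [h1 h2 h3 h4]; rewrite /half_box /box /= !in_itv /=.
  by split => // -[[_ h5]|[_ h5]]; lra.
apply: (le_trans (area_mono XP)).
have -> : area (P `\` (E1 `|` E2)) = (area P - area (P `&` (E1 `|` E2)))%E.
  apply: measureD => //; first exact: measurableU.
  by change (area P < +oo)%E; rewrite aP ltry.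
have -> : P `&` (E1 `|` E2) = E1 `|` E2.
  apply/setIidPr => p.
  change (half_box (1 - k) 1 0 d (-1) (sin w) (oblq w p) \/ half_box 0 d (1 - k) 1 (sin w) (-1) (oblq w p) ->
    box true false 0 1 0 1 (oblq w p)).
  move: (oblq w p) => q; rewrite /half_box /box /= !in_itv /= => -[[[g1 g2] _]|[[g1 g2] _]]; lra.
have -> : area (E1 `|` E2) = (area E1 + area E2)%E by exact: measureU.
rewrite aP; move: a1 a2; rewrite -/E1 -/E2.
have e1 : (0 <= area E1)%E by exact: measure_ge0.
have e2 : (0 <= area E2)%E by exact: measure_ge0.
have kd : k * d = k ^+ 2 / sin w by rewrite /d expr2 mulrA.
move: e1 e2; case: (area E1) => [x| |]; case: (area E2) => [y| |] //= _ _; rewrite ?leNye//.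
by rewrite -EFinD !lee_fin -kd; lra.
Qed.

End AreaBound.

(** * Hausdorff distance and numerical inequalities *)

Section Hausdorff.
Context {R : realType}.
Implicit Types (X Y : set (R * R)) (p q : R * R) (t : R).
Notation dist := (@Defs.edist R).

Lemma dot_dist p q t : dot p (u_ t) <= dot q (u_ t) + dist p q.
Proof.
rewrite -lerBlDl /Defs.edist; set x := p.1 - q.1; set y := p.2 - q.2.
have -> : dot p (u_ t) - dot q (u_ t) = x * cos t + y * sin t by rewrite /dot /x /y /=; ring.
apply: (le_trans (ler_norm _)); rewrite -sqrtr_sqr; apply: ler_wsqrtr.
have e : (x ^+ 2 + y ^+ 2) * (cos t ^+ 2 + sin t ^+ 2) =
  (x * cos t + y * sin t) ^+ 2 + (x * sin t - y * cos t) ^+ 2 by ring.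
by rewrite cos2Dsin2 mulr1 in e; rewrite e lerDl sqr_ge0.
Qed.

Lemma dist_bounded X q : compact X -> exists M, forall p, X p -> dist p q <= M.
Proof.
move=> /compact_coord[M M0 hM].
exists ((M + `|q.1|) + (M + `|q.2|)) => p /hM [h1 h2].
have a1 : `|p.1 - q.1| <= M + `|q.1| by apply: (le_trans (ler_normB _ _)); rewrite lerD2r.
have a2 : `|p.2 - q.2| <= M + `|q.2| by apply: (le_trans (ler_normB _ _)); rewrite lerD2r.
apply: (@le_trans _ _ (`|p.1 - q.1| + `|p.2 - q.2|)); last exact: lerD.
rewrite /Defs.edist -[leRHS]ger0_norm ?addr_ge0// -sqrtr_sqr; apply: ler_wsqrtr.
rewrite -(real_normK (num_real (p.1 - q.1))) -(real_normK (num_real (p.2 - q.2))).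
have := normr_ge0 (p.1 - q.1); have := normr_ge0 (p.2 - q.2).
move: (`|_|) (`|_|) => x y hx hy.
have : 0 <= x * y by rewrite mulr_ge0.
by rewrite sqrrD; lra.
Qed.

(** Each point of [X] has a point of [Y] within [excess X Y], up to any positive error. *)
Lemma supp_excess X Y t : X !=set0 -> compact X -> Y !=set0 -> compact Y ->
  supp X t <= supp Y t + excess X Y.
Proof.
move=> X0 cX [q0 Yq0] cY; apply: supp_le => // p Xp.
pose D := [set inf [set dist p q | q in Y] | p in X].
have lb p' : has_lbound [set dist p' q | q in Y].
  by exists 0 => _ [q _ <-]; exact: sqrtr_ge0.
have ubD : has_ubound D.
  have [M hM] := dist_bounded q0 cX.
  exists M => _ [p' Xp' <-]; apply: le_trans (hM _ Xp').
  by apply: ge_inf => //; exists q0.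
apply/ler_addgt0Pr => e e0.
have hinf : has_inf [set dist p q | q in Y] by split => //; exists (dist p q0), q0.
have [_ [q Yq <-] hq] := inf_adherent e0 hinf.
have h1 : inf [set dist p q | q in Y] <= excess X Y by apply: ub_le_sup => //; exists p.
have h2 := dot_dist p q t; have h3 := supp_ub t cY Yq.
lra.
Qed.

Lemma supp_hausdorff X Y t : X !=set0 -> compact X -> Y !=set0 -> compact Y ->
  `|supp X t - supp Y t| <= hausdorff_dist X Y.
Proof.
move=> X0 cX Y0 cY; have h1 := supp_excess t X0 cX Y0 cY; have h2 := supp_excess t Y0 cY X0 cX.
rewrite ler_norml /hausdorff_dist; apply/andP; split.
  rewrite lerNl opprB; apply: (@le_trans _ _ (excess Y X)); first by lra.
  by rewrite le_max lexx orbT.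
apply: (@le_trans _ _ (excess X Y)); first by lra.
by rewrite le_max lexx.
Qed.

End Hausdorff.

Section Numerics.
Context {R : realType}.
Implicit Types (c s T : R).

(** [T] is the first coordinate of [o_ w], the tangent of half of [pi / 2 - w]. It makes [c] and [s]
    rational, and [c <= 5 / 11] becomes [T <= 1 / 4] with little to spare. *)
Lemma tan_half_param c s : 0 < c -> 0 < s -> c ^+ 2 + s ^+ 2 = 1 -> c <= 5 / 11 ->
  exists T, [/\ 0 < T <= 1 / 4, c * (1 + T ^+ 2) = 2 * T, s * (1 + T ^+ 2) = 1 - T ^+ 2 & c * T = 1 - s].
Proof.
move=> c0 s0 cs c5; have s1 : s < 1 by nra.
have cne : c != 0 by lra.
pose T := (1 - s) / c; have cT : c * T = 1 - s by rewrite /T mulrC divfK.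
have T0 : 0 < T by rewrite divr_gt0; lra.
have e1 : T * (1 + s) = c.
  apply: (mulfI cne); rewrite mulrA cT.
  have -> : (1 - s) * (1 + s) = (c ^+ 2 + s ^+ 2) - s ^+ 2 by rewrite cs; ring.
  by ring.
have e2 : s * (1 + T ^+ 2) = 1 - T ^+ 2.
  have : T * c = T ^+ 2 + T ^+ 2 * s by rewrite -e1; ring.
  lra.
have e3 : c * (1 + T ^+ 2) = 2 * T by rewrite -e1; have := e2; nra.
exists T; split => //; apply/andP; split => //.
have T1 : T < 1 by nra.
rewrite leNgt; apply/negP => hT.
have h1 : 0 <= (T - 1 / 4) * (1 - T) by apply: mulr_ge0; lra.
have h2 : 2 * T <= 5 / 11 * (1 + T ^+ 2).
  by rewrite -e3 ler_pM2r//; have := sqr_ge0 T; lra.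
lra.
Qed.

(** The number [2 * s - 1 - c] is the leg of the two triangles that are cut from the unit square when
    both tips are at distance [1 + 2 * T]. The claim is that the rest has area less than 2.2. *)
Lemma corner_area_ineq c s : 0 < c -> 0 < s -> c ^+ 2 + s ^+ 2 = 1 -> c <= 5 / 11 ->
  0 < 2 * s - 1 - c /\ s * (1 - 22 / 10 * c) < (2 * s - 1 - c) ^+ 2.
Proof.
move=> c0 s0 cs c5; have [T [/andP[T0 T4] hc hs cT]] := tan_half_param c0 s0 cs c5.
have D0 : 0 < 1 + T ^+ 2 by have := sqr_ge0 T; lra.
have k : (2 * s - 1 - c) * (1 + T ^+ 2) = (1 - 3 * T) * (1 + T).
  have -> : (2 * s - 1 - c) * (1 + T ^+ 2) = 2 * (s * (1 + T ^+ 2)) - (1 + T ^+ 2) - c * (1 + T ^+ 2) by ring.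
  by rewrite hc hs; ring.
split.
  by rewrite -(pmulr_lgt0 _ D0) k mulr_gt0//; lra.
have D2 : 0 < (1 + T ^+ 2) ^+ 2 by rewrite exprn_gt0.
rewrite -(ltr_pM2r D2).
have -> : (2 * s - 1 - c) ^+ 2 * (1 + T ^+ 2) ^+ 2 = ((1 - 3 * T) * (1 + T)) ^+ 2 by rewrite -k; ring.
have -> : s * (1 - 22 / 10 * c) * (1 + T ^+ 2) ^+ 2 = (1 - T ^+ 2) * (1 + T ^+ 2 - 22 / 10 * (2 * T)).
  by rewrite -hc -hs; ring.
have -> : (1 - T ^+ 2) * (1 + T ^+ 2 - 22 / 10 * (2 * T)) =
  (1 + T) * ((1 - T) * (1 - 44 / 10 * T + T ^+ 2)) by ring.
have -> : ((1 - 3 * T) * (1 + T)) ^+ 2 = (1 + T) * ((1 - 3 * T) ^+ 2 * (1 + T)) by ring.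
rewrite ltr_pM2l; last by lra.
have : 0 < T * (4 / 10 - 24 / 10 * T + 10 * T ^+ 2).
  by rewrite mulr_gt0//; have := sqr_ge0 (T - 12 / 100); lra.
lra.
Qed.

(** In terms of [T], with the square of [1 + T ^ 2] replaced by its lower bound [1 + 2 * T ^ 2], the
    difference of the two sides has the factor [1 - 4 * T]. *)
Lemma balance_ineq c s : 0 < c -> 0 < s -> c ^+ 2 + s ^+ 2 = 1 -> c <= 5 / 11 ->
  ((2 * s - 1 - c) / s) ^+ 2 + (2 * c) ^+ 2 <= 1.
Proof.
move=> c0 s0 cs c5; have [T [/andP[T0 T4] hc hs cT]] := tan_half_param c0 s0 cs c5.
have D0 : 0 < 1 + T ^+ 2 by have := sqr_ge0 T; lra.
have sE : s = (1 - T ^+ 2) / (1 + T ^+ 2) by rewrite -hs mulfK//; lra.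
have cE : c = 2 * T / (1 + T ^+ 2) by rewrite -hc mulfK//; lra.
have T1 : 0 < 1 - T by lra.
have T2 : 0 < 1 + T by lra.
have nz1 : 1 + T * T != 0 by rewrite -expr2; lra.
have -> : (2 * s - 1 - c) / s = (1 - 3 * T) / (1 - T).
  rewrite sE cE; field.
  by rewrite !expr2 in D0 *; apply/and3P; split; nra.
have -> : ((1 - 3 * T) / (1 - T)) ^+ 2 = 1 - 4 * T * (1 - 2 * T) / (1 - T) ^+ 2 by field; lra.
have -> : (2 * c) ^+ 2 = 16 * T ^+ 2 / (1 + T ^+ 2) ^+ 2 by rewrite cE; field; rewrite expr2 in D0; lra.
suff : 16 * T ^+ 2 / (1 + T ^+ 2) ^+ 2 <= 4 * T * (1 - 2 * T) / (1 - T) ^+ 2 by lra.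
rewrite ler_pdivrMr ?exprn_gt0// mulrAC ler_pdivlMr ?exprn_gt0//.
have -> : 16 * T ^+ 2 * (1 - T) ^+ 2 = 4 * T * (4 * T * (1 - T) ^+ 2) by ring.
have -> : 4 * T * (1 - 2 * T) * (1 + T ^+ 2) ^+ 2 = 4 * T * ((1 - 2 * T) * (1 + T ^+ 2) ^+ 2) by ring.
rewrite ler_pM2l; last by lra.
have h1 : (1 - 2 * T) * (1 + 2 * T ^+ 2) <= (1 - 2 * T) * (1 + T ^+ 2) ^+ 2.
  by rewrite ler_pM2l; [have := sqr_ge0 (T ^+ 2); lra|lra].
(* The product equals (1 - 2 T) (1 + 2 T^2) - 4 T (1 - T)^2. *)
have h2 : 0 <= (1 - 4 * T) * (1 - 2 * T + 2 * T ^+ 2).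
  by apply: mulr_ge0; [lra|have := sqr_ge0 T; lra].
lra.
Qed.

End Numerics.

(** * A blocking point contradicts balance *)

Section Blocked.
Context {R : realType}.
Variables (w : R) (K : set (R * R)).
Hypotheses (hw : 0 < w < pi / 2) (c5 : cos w <= 5 / 11) (bK : balanced_maximum_cap w K).
Let c := cos w.
Let s := sin w.

Let c0 : 0 < c.
Proof. by have [] := @trig_bounds R w 0 hw ltac:(have := hw; lra). Qed.
Let s0 : 0 < s <= 1.
Proof. by rewrite sin_le1 andbT; apply: sin_gt0_pihalf. Qed.
Let cs : c ^+ 2 + s ^+ 2 = 1.
Proof. exact: cos2Dsin2. Qed.

(** Two support numbers at once, because the balance inequality involves two of them. *)
Lemma maximum_cap_near t t' (e : R) : 0 < e -> exists Theta K', [/\ maximum_polygon_cap w Theta K',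
  `|supp K' t - supp K t| < e & `|supp K' t' - supp K t'| < e].
Proof.
move=> e0; have [[[K0 cK _] _ _ _] [n [K_ [_ _ _ Kmax Klim]]]] := bK.
have [i _ hi] : exists2 i, True & `|hausdorff_dist (K_ i) K| < e.
  have /= [N _ hN] := @cvgr0_norm_lt _ _ _ _ _ _ Klim _ e0.
  by exists N => //; apply: hN => /=.
have [_ [[[Ki0 cKi _] _ _ _] _] _ _] := Kmax i.
exists (uniform_angle_set w (n i)), (K_ i); split => //.
  by apply: le_lt_trans hi; apply: (le_trans (supp_hausdorff t Ki0 cKi K0 cK)); exact: ler_norm.
by apply: le_lt_trans hi; apply: (le_trans (supp_hausdorff t' Ki0 cKi K0 cK)); exact: ler_norm.
Qed.

(** By Cauchy-Schwarz this follows from [balance_ineq]: the coefficients on the left have norm at most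
    one. *)
Lemma long_tip_slope l eta : c + 2 * (1 - s) < c * l -> 0 <= eta <= w ->
  (1 - c * l) / s * sin eta + 2 * c * cos eta <= 1.
Proof.
move=> ll he; have c0' := c0; have s0' := s0; have hw' := hw; have p0 := pi_gt0 R.
have se : 0 <= sin eta by apply: sin_ge0_pi; lra.
have ce : 0 <= cos eta by apply: cos_ge0_pihalf; lra.
have [k0 _] := corner_area_ineq c0' (proj1 (andP s0')) cs c5.
have := balance_ineq c0' (proj1 (andP s0')) cs c5.
set E := (2 * s - 1 - c) / s => hE.
have E0 : 0 <= E by rewrite divr_ge0//; lra.
have h1 : (1 - c * l) / s * sin eta <= E * sin eta.
  by apply: ler_wpM2r => //; rewrite /E ler_pM2r ?invr_gt0//; lra.
suff : E * sin eta + 2 * c * cos eta <= 1 by lra.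
have X0 : 0 <= E * sin eta + 2 * c * cos eta.
  by apply: addr_ge0; apply: mulr_ge0 => //; lra.
rewrite -(@ler_pXn2r _ 2) ?nnegrE// expr1n.
have e1 : (E ^+ 2 + (2 * c) ^+ 2) * (cos eta ^+ 2 + sin eta ^+ 2) =
  (E * sin eta + 2 * c * cos eta) ^+ 2 + (E * cos eta - 2 * c * sin eta) ^+ 2 by ring.
rewrite cos2Dsin2 mulr1 in e1.
have := sqr_ge0 (E * cos eta - 2 * c * sin eta); lra.
Qed.

Lemma long_tip_ge l : c + 2 * (1 - s) < c * l -> 2 * c <= l.
Proof.
move=> ll; have c0' := c0; have s0' := s0; have c5' : c <= 5 / 11 := c5.
apply/ltW/(@le_lt_trans _ _ 1); first by lra.
by rewrite -(ltr_pM2l c0'); lra.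
Qed.

(** If the edge bound for [K] is strictly less than [2 * c], it is so for a maximum polygon cap close
    to [K], against the balance. *)
Lemma balance_gap_absurd t t' eta (co : R) : 0 < sin eta ->
  1 - (co - c * supp K t) / sin eta < 2 * c ^+ 2 -> c + 2 * (1 - s) < c * supp K t' ->
  (forall Theta K', maximum_polygon_cap w Theta K' -> c + 2 * (1 - s) < c * supp K' t' ->
     c * (2 * c) <= 1 - (co - c * supp K' t) / sin eta) -> False.
Proof.
move=> se; set X := 1 - _ => hgap ll hbal; have c0' := c0.
have hl : 1 + 2 * (1 - s) / c < supp K t'.
  by rewrite -(ltr_pM2l c0') mulrDr mulr1 [c * (_ / c)]mulrC divfK//; lra.
pose e : R := Num.min ((2 * c ^+ 2 - X) * sin eta / c) (supp K t' - (1 + 2 * (1 - s) / c)).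
have e0 : 0 < e.
  by rewrite /e lt_min subr_gt0 hl andbT divr_gt0// mulr_gt0//; lra.
have [ea eb] : e <= (2 * c ^+ 2 - X) * sin eta / c /\ e <= supp K t' - (1 + 2 * (1 - s) / c).
  by rewrite /e !ge_min !lexx orbT.
have [Th [K' [maxK' h1 h2]]] := maximum_cap_near t t' e0.
move: h1 h2; rewrite !ltr_norml => /andP[_ h1] /andP[h2 _].
have hl' : c + 2 * (1 - s) < c * supp K' t'.
  have h : 1 + 2 * (1 - s) / c < supp K' t' by lra.
  rewrite -(ltr_pM2l c0') mulrDr mulr1 [c * (_ / c)]mulrC divfK// in h; lra.
have := hbal _ _ maxK' hl'.
have h3 : c * supp K' t < c * supp K t + (2 * c ^+ 2 - X) * sin eta.
  have h : supp K' t < supp K t + (2 * c ^+ 2 - X) * sin eta / c by lra.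
  rewrite -(ltr_pM2l c0') mulrDr [c * (_ / c)]mulrC divfK// in h; lra.
have -> : 1 - (co - c * supp K' t) / sin eta = X + (c * supp K' t - c * supp K t) / sin eta.
  by rewrite /X; field; lra.
have : (c * supp K' t - c * supp K t) / sin eta < 2 * c ^+ 2 - X.
  by rewrite ltr_pdivrMr//; lra.
lra.
Qed.

Variable z : R * R.
Hypothesis hz : forall t, 0 <= t <= w -> ~ Qminus K t z.

Let block t : 0 <= t <= w -> supp K t - 1 <= dot z (u_ t) \/ supp K (t + pi / 2) - 1 <= dot z (v_ t).
Proof.
move=> /hz nQ; have [|h1] := leP (supp K t - 1) (dot z (u_ t)); first by left.
have [|h2] := leP (supp K (t + pi / 2) - 1) (dot z (v_ t)); first by right.
by case: nQ.
Qed.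

(** The blocking point makes the upper right edge of [K] shorter than [2 * c] ([blocked_support]),
    while the balance makes it at least that long ([balance_left]). *)
Lemma blocked_left phi : 0 <= dot z (u_ w) ->
  (1 - s) / c - dot z (v_ w) < c -> 0 <= phi < pi / 2 ->
  1 < (1 - dot z (u_ w)) * cos phi + ((1 - s) / c - dot z (v_ w)) * sin phi ->
  c + 2 * (1 - s) < c * supp K (w + pi / 2) -> False.
Proof.
move=> al0 Dc hphi hwide ll; have hw' := hw; have c0' := c0; have s0' := s0; have c5' : c <= 5 / 11 := c5.
have [[[K0 cK _] _ _ _] _] := bK; have [capK _] := bK; have p0 := pi_gt0 R.
have dotE (p : R * R) eta : dot p (u_ (w - eta)) = dot p (u_ w) * cos eta - dot p (v_ w) * sin eta.
  by rewrite /dot /= cosB sinB; ring.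
have dotvE (p : R * R) eta : dot p (v_ (w - eta)) = dot p (v_ w) * cos eta + dot p (u_ w) * sin eta.
  by rewrite /dot /= cosB sinB; ring.
have [| | | | | | | | |eta he hgap] := @blocked_support R w (supp K (w + pi / 2)) (dot z (u_ w))
  (dot z (v_ w)) phi (supp K) => //.
- by rewrite -/c; lra.
- by move=> eta he; rewrite -dotE -dotvE; apply: block; lra.
- move=> eta he; have ce : 0 < cos eta by apply: cos_gt0_pihalf; lra.
  have se : 0 <= sin eta by apply: sin_ge0_pi; lra.
  rewrite -ler_pdivlMr//; apply: supp_le => // p Kp; rewrite ler_pdivlMr// -dot_v.
  apply: (le_trans _ (supp_ub _ cK Kp)); rewrite -dot_v dotvE lerDl.
  by apply: mulr_ge0 => //; have [/andP[]] := cap_square capK Kp.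
have se : 0 < sin eta by apply: sin_gt0_pihalf; lra.
apply: (balance_gap_absurd se hgap ll) => Th K' maxK' hl'.
have := @balance_left R w Th K' hw maxK' (w - eta) (2 * c) _ (long_tip_ge hl') (fun x => long_tip_slope hl').
rewrite (_ : w - (w - eta) = eta); last by ring.
by apply; lra.
Qed.

(** The reflection of [blocked_left]: [z.2] and [z.1] are the products of the reflected point with
    [u_ w] and [v_ w]. *)
Lemma blocked_right phi : 0 <= z.2 ->
  (1 - s) / c - z.1 < c -> 0 <= phi < pi / 2 ->
  1 < (1 - z.2) * cos phi + ((1 - s) / c - z.1) * sin phi ->
  c + 2 * (1 - s) < c * supp K 0 -> False.
Proof.
move=> al0 Dc hphi hwide ll; have hw' := hw; have c0' := c0; have s0' := s0; have c5' : c <= 5 / 11 := c5.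
have [[[K0 cK _] _ _ _] _] := bK; have [capK _] := bK; have p0 := pi_gt0 R.
have angE eta : w + pi / 2 - (w - eta) = eta + pi / 2 by ring.
have angE' eta : w + pi / 2 - (w - eta + pi / 2) = eta by ring.
have [| | | | | | | | |eta he hgap] := @blocked_support R w (supp K 0) z.2 z.1 phi (fun t =>
  supp K (w + pi / 2 - t)) => //.
- by rewrite -/c; lra.
- move=> eta he; rewrite angE angE'.
  have -> : z.2 * cos eta - z.1 * sin eta = dot z (v_ eta) by rewrite /dot /=; ring.
  have -> : z.1 * cos eta + z.2 * sin eta = dot z (u_ eta) by rewrite /dot /=; ring.
  by have [] := block he; [right|left].
- move=> eta he; have ce : 0 < cos eta by apply: cos_gt0_pihalf; lra.
  have se : 0 <= sin eta by apply: sin_ge0_pi; lra.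
  rewrite angE' -ler_pdivlMr//; apply: supp_le => // p Kp; rewrite ler_pdivlMr//.
  apply: (le_trans _ (supp_ub _ cK Kp)); rewrite /dot /= cos0 sin0 mulr0 addr0 mulr1 lerDl.
  by apply: mulr_ge0 => //; have [_ /andP[]] := cap_square capK Kp.
have se : 0 < sin eta by apply: sin_gt0_pihalf; lra.
rewrite angE in hgap.
apply: (balance_gap_absurd se hgap ll) => Th K' maxK' hl'.
have := @balance_right R w Th K' hw maxK' (w - eta) (2 * c) _ (long_tip_ge hl') (fun x => long_tip_slope hl').
rewrite (_ : w - (w - eta) = eta); last by ring.
by apply; lra.
Qed.

End Blocked.

(** * The sofa fits in every late strip *)

Section Strip.
Context {R : realType}.
Implicit Types (w t theta : R) (K S : set (R * R)) (p z : R * R).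

(** Otherwise the rhombus cut off at distance [1 + 2 * (o_ w).1] from the bottom corner along both lower
    edges would contain [K], and its area is less than 2.2. *)
Lemma long_tip w K : 0 < w < pi / 2 -> cos w <= 5 / 11 -> cap w K -> ((22 / 10)%:E <= area K)%E ->
  cos w + 2 * (1 - sin w) < cos w * supp K 0 \/ cos w + 2 * (1 - sin w) < cos w * supp K (w + pi / 2).
Proof.
move=> hw c5 capK aK; have [c0 _ _ _ _] := @trig_bounds R w 0 hw ltac:(lra).
have s0 : 0 < sin w by apply: sin_gt0_pihalf.
have [_ cK _] := let: And4 x _ _ _ := capK in x.
have [|hr] := ltP (cos w + 2 * (1 - sin w)) (cos w * supp K 0); first by left.
have [|hl] := ltP (cos w + 2 * (1 - sin w)) (cos w * supp K (w + pi / 2)); first by right.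
exfalso; have s1 := sin_le1 w.
have [k0 hk] := corner_area_ineq c0 s0 (cos2Dsin2 w) c5.
set k := 2 * sin w - 1 - cos w in k0 hk.
have hk' k' : 0 <= k' -> k' < k -> k' ^+ 2 <= sin w * (1 - 22 / 10 * cos w).
  move=> k'0 k'k.
  have ks : k' < sin w by rewrite /k in k'k; lra.
  have h := @area_truncated_le R w k' K c0 s0 k'0 ks.
  have : ((22 / 10)%:E <= ((cos w)^-1 * (1 - k' ^+ 2 / sin w))%:E)%E.
    apply: (le_trans aK); apply: h => p Kp; have [h1 h2] := cap_square capK Kp; split => //.
      rewrite oblq_x; have : cos w * dot p (u_ 0) <= cos w * supp K 0 by rewrite ler_pM2l//; exact: supp_ub.
      by rewrite /k in k'k; lra.
    rewrite oblq_v; have : cos w * dot p (u_ (w + pi / 2)) <= cos w * supp K (w + pi / 2).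
      by rewrite ler_pM2l//; exact: supp_ub.
    by rewrite /k in k'k; lra.
  rewrite lee_fin [leRHS]mulrC ler_pdivlMr// => h3.
  have h4 : k' ^+ 2 / sin w <= 1 - 22 / 10 * cos w by lra.
  by rewrite ler_pdivrMr// in h4; lra.
set m := sin w * _ in hk hk'.
have m0 : 0 <= m by have := hk' 0 (lexx _) k0; rewrite expr0n.
(* Half of the gap in hk: then (k - d)^2 still exceeds m. *)
pose d := (k ^+ 2 - m) / (4 * k).
have dk : d * (4 * k) = k ^+ 2 - m by rewrite /d divfK//; lra.
have d0 : 0 < d by rewrite divr_gt0//; lra.
have dk2 : d <= k.
  by rewrite /d ler_pdivrMr; [have := sqr_ge0 k; rewrite expr2 in hk *; nra|lra].
have := hk' (k - d) ltac:(lra) ltac:(lra).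
have := sqr_ge0 d.
rewrite sqrrB; lra.
Qed.

(** If the inequality fails at [theta], the point [z] is further than one below the line through [o_ w] with
    normal [u_ theta]. The same inequality read in the frames of the two lower edges ([wide1], [wide2])
    makes [z] a blocking point for either tip. *)
Lemma sofa_in_strip w K z theta : 0 < w < pi / 2 -> cos w <= 5 / 11 -> balanced_maximum_cap w K ->
  ((22 / 10)%:E <= area K)%E -> (forall t, 0 <= t <= w -> ~ Qminus K t z) ->
  0 <= dot z (u_ w) -> 0 <= z.2 -> w <= theta <= pi / 2 -> supp K theta - 1 <= dot z (u_ theta).
Proof.
move=> hw c5 bK aK hz al0 be0 hth; have [capK _] := bK; have p0 := pi_gt0 R.
have [c0 _ _ _ _] := @trig_bounds R w 0 hw ltac:(lra).
have s0 : 0 < sin w by apply: sin_gt0_pihalf.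
have s1 := sin_le1 w; have sc := cos2Dsin2 w.
have [[K0 cK _] _ _ _] := capK.
rewrite leNgt; apply/negP => hlt.
have ct : 0 <= cos theta by apply: cos_ge0_pihalf; lra.
have st : 0 <= sin theta by apply: sin_ge0_pi; lra.
have sd : 0 <= sin (theta - w) by apply: sin_ge0_pi; lra.
have cd : 0 <= cos (theta - w) by apply: cos_ge0_pihalf; lra.
have dotE p : cos w * dot p (u_ theta) = dot p (u_ w) * cos theta + p.2 * sin (theta - w).
  by rewrite -side_u_dot /side_u /= -[w - theta]opprB sinN; ring.
have hs : supp K theta <= (cos theta + sin (theta - w)) / cos w.
  apply: supp_le => // p Kp; rewrite ler_pdivlMr// mulrC dotE.
  have [/andP[_ h1] /andP[_ h2]] := cap_square capK Kp.
  by apply: lerD; rewrite ler_piMl.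
have wide : cos w < (1 - dot z (u_ w)) * cos theta + (1 - z.2) * sin (theta - w).
  have h1 : dot z (u_ theta) + 1 < (cos theta + sin (theta - w)) / cos w by lra.
  by rewrite ltr_pdivlMr// in h1; have := dotE z; lra.
have cne : cos w != 0 by lra.
have e1 := oblq_v w z; rewrite -dot_v in e1; have e2 := oblq_x w z; rewrite /oblq /= in e1 e2.
have z1E : dot z (u_ 0) = z.1 by rewrite /dot /= cos0 sin0; ring.
rewrite z1E in e2.
pose D1 := (1 - sin w) / cos w - dot z (v_ w); pose D2 := (1 - sin w) / cos w - z.1.
have cD1 : cos w * D1 = 1 - sin w - cos w * dot z (v_ w) by rewrite /D1 mulrBr [cos w * (_ / _)]mulrC divfK.
have cD2 : cos w * D2 = 1 - sin w - cos w * z.1 by rewrite /D2 mulrBr [cos w * (_ / _)]mulrC divfK.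
(* z is more than one away from o_ w in direction u_ theta, in the frame (u_ w, v_ w). *)
have wide1 : 1 < (1 - dot z (u_ w)) * cos (theta - w) + D1 * sin (theta - w).
  rewrite -(ltr_pM2l c0) mulr1; apply: (lt_le_trans wide); rewrite le_eqVlt; apply/orP; left; apply/eqP.
  have -> : cos theta = cos w * cos (theta - w) - sin w * sin (theta - w).
    by rewrite -cosD; congr cos; ring.
  have -> : cos w * ((1 - dot z (u_ w)) * cos (theta - w) + D1 * sin (theta - w)) =
    cos w * (1 - dot z (u_ w)) * cos (theta - w) + (cos w * D1) * sin (theta - w) by ring.
  by rewrite cD1 -e1; ring.
(* The same in the reflected frame, where the angle is measured from the vertical. *)
have wide2 : 1 < (1 - z.2) * cos (pi / 2 - theta) + D2 * sin (pi / 2 - theta).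
  have -> : cos (pi / 2 - theta) = sin theta by rewrite cosB cos_pihalf sin_pihalf; ring.
  have -> : sin (pi / 2 - theta) = cos theta by rewrite sinB cos_pihalf sin_pihalf; ring.
  rewrite -(ltr_pM2l c0) mulr1; apply: (lt_le_trans wide); rewrite le_eqVlt; apply/orP; left; apply/eqP.
  rewrite sinB.
  have -> : cos w * ((1 - z.2) * sin theta + D2 * cos theta) =
    cos w * (1 - z.2) * sin theta + (cos w * D2) * cos theta by ring.
  by rewrite cD2 -e2; ring.
have D10 : 0 < D1.
  by apply: (wide_gt0 al0 _ sd wide1); rewrite cd cos_le1.
have D20 : 0 < D2.
  apply: (wide_gt0 be0 _ _ wide2).
    by rewrite cos_le1 andbT; apply: cos_ge0_pihalf; lra.
  by apply: sin_ge0_pi; lra.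
have D10' : 0 < cos w * D1 by rewrite mulr_gt0.
have D20' : 0 < cos w * D2 by rewrite mulr_gt0.
have cc : cos w * cos w = 1 - sin w * sin w by rewrite -sc; ring.
have small (x y : R) : 0 <= y -> x - sin w * y < 1 - sin w -> 1 - sin w - (y - sin w * x) < cos w * cos w.
  move=> y0 h; have h1 : sin w * (x - sin w * y) < sin w * (1 - sin w) by rewrite ltr_pM2l.
  have h2 : sin w * sin w * y <= y by rewrite ler_piMl// mulr_ile1// ltW.
  rewrite cc; lra.
have D1c : D1 < cos w.
  by rewrite -(ltr_pM2l c0) cD1 -e1; apply: small => //; lra.
have D2c : D2 < cos w.
  by rewrite -(ltr_pM2l c0) cD2 -e2; apply: small => //; lra.
have [hr|hl] := long_tip hw c5 capK aK.
  by apply: (blocked_right hw c5 bK hz be0 D2c _ wide2 hr); lra.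
by apply: (blocked_left hw c5 bK hz al0 D1c _ wide1 hl); lra.
Qed.

End Strip.

(** * The movement *)

Section Movement.
Context {R : realType}.
Implicit Types (K S : set (R * R)) (p : R * R) (t : R).

(** A bounded set has a Lipschitz support function. *)
Lemma continuous_supp K : K !=set0 -> compact K -> continuous (supp K).
Proof.
move=> K0 cK; have [M M0 hM] := compact_coord cK.
have lip t t' : supp K t' <= supp K t + M * (`|cos t' - cos t| + `|sin t' - sin t|).
  apply: supp_le => // p Kp; have [h1 h2] := hM _ Kp.
  have := supp_ub t cK Kp.
  have : dot p (u_ t') - dot p (u_ t) <= M * (`|cos t' - cos t| + `|sin t' - sin t|).
    have -> : dot p (u_ t') - dot p (u_ t) = p.1 * (cos t' - cos t) + p.2 * (sin t' - sin t).
      by rewrite /dot /=; ring.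
    rewrite [leRHS]mulrDr; apply: lerD; apply: (le_trans (ler_norm _)); rewrite normrM; exact: ler_wpM2r.
  lra.
move=> t; apply/cvgrPdist_lt => e e0.
have M1 : 0 < M + 1 by lra.
have e1 : 0 < e / (2 * (M + 1)) by rewrite divr_gt0//; lra.
have := @continuous_cos R t => /cvgrPdist_lt /(_ _ e1) hc.
have := @continuous_sin R t => /cvgrPdist_lt /(_ _ e1) hs.
near=> t'.
have h1 : `|cos t - cos t'| < e / (2 * (M + 1)) by near: t'.
have h2 : `|sin t - sin t'| < e / (2 * (M + 1)) by near: t'.
have l1 := lip t t'; have l2 := lip t' t.
rewrite [`|cos t' - _|]distrC [`|sin t' - _|]distrC in l1.
have h3 : M * (`|cos t - cos t'| + `|sin t - sin t'|) < e.
  apply: (@le_lt_trans _ _ (M * (e / (2 * (M + 1)) + e / (2 * (M + 1))))).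
    by apply: ler_wpM2l => //; apply: lerD; exact: ltW.
  have -> : e / (2 * (M + 1)) + e / (2 * (M + 1)) = e / (M + 1) by field; lra.
  rewrite mulrA ltr_pdivrMr//; nra.
rewrite ltr_norml; lra.
Unshelve. all: by end_near. Qed.

(** At time [x], the isometry that carries the supporting hallway of angle [x * (pi / 2)] onto [L]. *)
Definition hallway_motion K (x : R) : (R * R) * (R * R) :=
  let t := x * (pi / 2) in
  ((cos t, - sin t), (1 - supp K t, 1 - supp K (t + pi / 2))).

Lemma continuous_pair (T U V : topologicalType) (f : T -> U) (g : T -> V) :
  continuous f -> continuous g -> continuous (fun x => (f x, g x)).
Proof. by move=> cf cg x; apply: cvg_pair; [exact: cf|exact: cg]. Qed.

Lemma hallway_motion_continuous K : K !=set0 -> compact K -> continuous (hallway_motion K).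
Proof.
move=> K0 cK; have cs := continuous_supp K0 cK.
have ct : continuous (fun x : R => x * (pi / 2)) by move=> y; apply: mulrr_continuous.
have ct' : continuous (fun x : R => x * (pi / 2) + pi / 2).
  by move=> x; apply: cvgD; [exact: ct|exact: cvg_cst].
suff [h1 h2] : continuous (fun x : R => (cos (x * (pi / 2)), - sin (x * (pi / 2)))) /\
    continuous (fun x : R => (1 - supp K (x * (pi / 2)), 1 - supp K (x * (pi / 2) + pi / 2))).
  by move=> x; exact: (cvg_pair (h1 x) (h2 x)).
split; apply: continuous_pair => x.
- by apply: (@continuous_comp _ _ _ (fun x : R => x * (pi / 2)) cos); [exact: ct|exact: continuous_cos].
- apply: cvgN.
  by apply: (@continuous_comp _ _ _ (fun x : R => x * (pi / 2)) sin); [exact: ct|exact: continuous_sin].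
- apply: cvgB; first exact: cvg_cst.
  by apply: (@continuous_comp _ _ _ (fun x : R => x * (pi / 2)) (supp K)); [exact: ct|exact: cs].
- apply: cvgB; first exact: cvg_cst.
  by apply: (@continuous_comp _ _ _ (fun x : R => x * (pi / 2) + pi / 2) (supp K)); [exact: ct'|exact: cs].
Qed.

Lemma se2_act_hallway K x p : se2_act (hallway_motion K x) p =
  (dot p (u_ (x * (pi / 2))) - supp K (x * (pi / 2)) + 1,
   dot p (v_ (x * (pi / 2))) - supp K (x * (pi / 2) + pi / 2) + 1).
Proof. by rewrite /se2_act /hallway_motion /dot /=; congr pair; ring. Qed.

Lemma rotated_copy0 S : rotated_copy 0 S = S.
Proof.
rewrite /rotated_copy; have E p : se2_act (u_ 0, (0, 0)) p = p.
  by case: p => x y; rewrite /se2_act /= cos0 sin0; congr pair; ring.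
by apply/seteqP; split => [_ [p Sp <-]|p Sp]; [rewrite E|exists p].
Qed.

Lemma hallway_movement K S : K !=set0 -> compact K -> S `<=` K ->
  supp K (pi / 2) = 1 -> (forall p, S p -> 0 <= p.2) ->
  (forall t, 0 <= t <= pi / 2 -> forall p, S p -> ~ Qminus K t p) ->
  movement S (hallway_motion K) /\ rotation_angle (hallway_motion K) (pi / 2).
Proof.
move=> K0 cK SK h1 S0 SQ; have p0 := pi_gt0 R.
have ang (x : R) : x \in `[0, 1] -> 0 <= x * (pi / 2) <= pi / 2.
  rewrite in_itv /= => hx; have hp : 0 <= pi / 2 :> R by lra.
  by rewrite mulr_ge0 ?ler_piMl//; lra.
split.
  split.
  - by move=> x _; rewrite /SE2 /= sqrrN cos2Dsin2.
  - by apply: continuous_subspaceT; exact: hallway_motion_continuous.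
  - by rewrite /se2_translation /hallway_motion /= mul0r cos0 sin0 oppr0.
  - move=> x hx _ [p Sp <-]; rewrite se2_act_hallway; have ht := ang _ hx.
    set t := x * (pi / 2) in ht *.
    have k1 := supp_ub t cK (SK _ Sp); have k2 := supp_ub (t + pi / 2) cK (SK _ Sp).
    rewrite -dot_v in k2.
    have [h|h] := leP (supp K t - 1) (dot p (u_ t)).
      by right; rewrite /V_L /=; lra.
    have [h'|h'] := leP (supp K (t + pi / 2) - 1) (dot p (v_ t)).
      by left; rewrite /H_L /=; lra.
    by case: (SQ _ ht _ Sp).
  - split=> _ [p Sp <-]; rewrite se2_act_hallway.
      rewrite mul0r add0r; have k1 := supp_ub 0 cK (SK _ Sp); have k2 := supp_ub (pi / 2) cK (SK _ Sp).
      rewrite dot_v add0r h1 in k2 *; rewrite dot_pihalf in k2 *.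
      by rewrite /H_L /=; have := S0 _ Sp; lra.
    rewrite mul1r; have k1 := supp_ub (pi / 2) cK (SK _ Sp); have k2 := supp_ub (pi / 2 + pi / 2) cK (SK _ Sp).
    rewrite dot_v h1 in k1 *; rewrite dot_pihalf in k1 *.
    by rewrite /V_L /=; have := S0 _ Sp; lra.
exists (fun x => x * (pi / 2)); split.
- by apply: continuous_subspaceT => y; apply: mulrr_continuous.
- by [].
- by rewrite mul0r.
- by rewrite mul1r.
Qed.

End Movement.

Theorem theorem1p5p2 (R : realType) (omega : R) (S : set (R * R)) :
  asec (22 / 10) <= omega <= pi / 2 ->
  balanced_maximum_sofa omega S ->
  ((22 / 10)%:E <= area S)%E ->
  exists theta : R,
    exists2 Phi : R -> (R * R) * (R * R),
      movement (rotated_copy theta S) Phi & rotation_angle Phi (pi / 2).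
Proof.
move=> /andP[w_ge w_le] [[S' [_ _ SE]] bK] aS; have p0 := pi_gt0 R.
set w := omega in w_ge w_le SE bK.
have [w0 c5] : 0 < w /\ cos w <= 5 / 11.
  have xr : -1 <= (22 / 10 : R)^-1 <= 1 by lra.
  have a0 : 0 < acos (22 / 10 : R)^-1 by apply: acos_gt0; lra.
  rewrite /asec in w_ge; split; first exact: lt_le_trans w_ge.
  have -> : 5 / 11 = cos (acos (22 / 10 : R)^-1) by rewrite acosK ?in_itv//=; field.
  move: w_ge; rewrite le_eqVlt => /orP[/eqP -> //|h].
  by apply/ltW; rewrite ltr_cos ?in_itv /=; lra.
have s0 : 0 < sin w by apply: sin_gt0_pi; lra.
set K := cap_of w S in bK; have [capK _] := bK.
have [[K0 cK _] [hKw hK2] _ _] := capK.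
have SP p : S p -> P_ w p by rewrite SE => -[].
have SL p t : S p -> 0 <= t <= w -> Qplus S' t p /\ ~ Qminus S' t p.
  by rewrite SE => -[_ h] ht; apply: h; rewrite /= in_itv.
have S0 : S !=set0.
  apply/set0P/negP => /eqP S0; move: aS; rewrite S0 /area measure0 lee_fin; lra.
have SK : S `<=` K.
  (* S is bounded: the supporting half-planes at the two extreme angles close off the strip. *)
  have [M hM] : exists M, forall p, S p -> `|p.1| <= M /\ `|p.2| <= M.
    pose a := supp S' 0; pose b := (1 + `|supp S' (w + pi / 2)|) / sin w.
    exists (`|a| + `|b| + 1) => p Sp.
    have [] := SP _ Sp; rewrite dot_pihalf => _ h2.
    have [[+ _] _] := SL _ 0 Sp ltac:(lra); have [[_ +] _] := SL _ w Sp ltac:(lra).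
    rewrite /dot /= cos0 sin0 mulr1 mulr0 addr0 -/a => h3 h4.
    have h5 : - p.1 <= b.
      rewrite /b ler_pdivlMr//; have := ler_norm (supp S' (w + pi / 2)).
      have hcw := cos_max w; have : 0 <= p.2 * (1 + cos w).
        by apply: mulr_ge0; [lra|have := cos_geN1 w; lra].
      have : p.2 * 1 <= 1 by lra.
      lra.
    have := ler_norm a; have := ler_norm b; have := normr_ge0 a; have := normr_ge0 b => *.
    by rewrite !ler_norml; lra.
  have ub p t : S p -> dot p (u_ t) <= supp S t.
    move=> Sp; apply: ub_le_sup; last by exists p.
    exists (M + M) => _ [q /hM[h1 h2] <-].
    exact: (le_trans (ler_norm _) (norm_dot_u _ h1 h2)).
  move=> p Sp; split; first exact: SP.
  by move=> t _; split; [exact: ub|rewrite dot_v; exact: ub].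
(* The inner quadrants of K are contained in those that the monotone sofa avoids. *)
have KS' t : 0 <= t <= w -> supp K t <= supp S' t /\ supp K (t + pi / 2) <= supp S' (t + pi / 2).
  move=> ht.
  have k1 : supp K t <= supp S t.
    by apply: supp_le => // p [_ h]; have [] := h t; rewrite /= ?in_itv.
  have k2 : supp K (t + pi / 2) <= supp S (t + pi / 2).
    by apply: supp_le => // p [_ h]; rewrite -dot_v; have [] := h t; rewrite /= ?in_itv.
  split; [apply: (le_trans k1)|apply: (le_trans k2)]; apply: supp_le => // p Sp.
    by have [[]] := SL _ t Sp ht.
  by rewrite -dot_v; have [[]] := SL _ t Sp ht.
have SQ t p : 0 <= t <= w -> S p -> ~ Qminus K t p.
  move=> ht Sp [h1 h2]; have [_] := SL _ t Sp ht; apply.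
  have [k1 k2] := KS' _ ht; split; lra.
have aK : ((22 / 10)%:E <= area K)%E by apply: (le_trans aS); exact: area_mono.
have hP p : S p -> 0 <= dot p (u_ w) /\ 0 <= p.2.
  by move=> /SP; rewrite /P_ /= dot_pihalf => -[/andP[? _] /andP[? _]].
have strip t p : w <= t <= pi / 2 -> S p -> supp K t - 1 <= dot p (u_ t).
  move=> ht Sp; have [a0 b0] := hP _ Sp.
  have [w_lt|w_eq] := ltP w (pi / 2).
    apply: (@sofa_in_strip R w K p t _ c5 bK aK _ a0 b0 ht); first by rewrite w0.
    by move=> t' ht'; exact: SQ.
  have -> : t = w by lra.
  by rewrite hKw subrr.
have [mv rot] : movement S (hallway_motion K) /\ rotation_angle (hallway_motion K) (pi / 2).
  apply: hallway_movement => //; first by move=> p /hP[].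
  move=> t ht p Sp; have [tw|wt] := leP t w; first by apply: SQ => //; lra.
  by move=> [h _]; have := strip t p ltac:(lra) Sp; lra.
by exists 0; exists (hallway_motion K); rewrite ?rotated_copy0.
Qed.
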